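(* Assume that $Q$ is bounded with diameter $R_0>0$, that the prox-function $d$ has quadratic growth with constant $C(d)$, and that the stochastic oracle is unbiased with $\sup_t\mathbf E\|\xi_t\|_*^2\le\sigma^2<\infty$. Let $N>4$ be an integer, $x_0\in Q$ deterministic, $$m=\left[\tfrac12\log_2\frac{\mu(d)N}{C(d)\log_2N}\right]-1,\qquad N_0=[N/m],\qquad r_k=2^{-k}R_0,\ k=0,1,\dots,m,$$ where $[a]$ is the largest integer less than or equal to $a$, and assume $m\ge1$. Define $y_0=x_0$ and, for $k=1,\dots,m$, $y_k=x_{N_0}(y_{k-1},R_0)$, the output of the stochastic dual averaging method with parameter $\gamma=\gamma_k=\frac{R_0^2}{r_{k-1}}\sqrt{\frac{L^2+\sigma^2}{2C(d)\mu(d)}}$. Let $\hat x_N=y_m$. (This procedure does not use $\rho$ or $\mu(f)$.) Then $$\mathbf E f(\hat x_N)-f^*\le4\left(\frac{16(L^2+\sigma^2)C(d)\log_2N}{\mu(f)^{2/\rho}\mu(d)N}\right)^{\frac\rho{2(\rho-1)}}.$$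
   Context: $E$ is a finite-dimensional real vector space with norm $\|\cdot\|$; $E^*$ is its dual, $\langle s,x\rangle$ the pairing, $\|s\|_*=\max_{\|x\|\le1}\langle s,x\rangle$; $B$ is the unit ball of $\|\cdot\|$ and $B_R(z)=\{y:\|y-z\|\le R\}$. Problem: $Q\subset E$ is a nonempty closed convex set, $f:Q\to\mathbb R$ is uniformly convex with parameters $\rho\ge2$ and $\mu(f)>0$, i.e. for all $x,y\in Q$, $\alpha\in[0,1]$, $$f(\alpha x+(1-\alpha)y)\le\alpha f(x)+(1-\alpha)f(y)-\tfrac12\mu(f)\alpha(1-\alpha)[\alpha^{\rho-1}+(1-\alpha)^{\rho-1}]\|x-y\|^\rho .$$ The subgradients $f'(x)\in E^*$ of $f$ at $x\in Q$ (i.e. $f(y)\ge f(x)+\langle f'(x),y-x\rangle$ for all $y\in Q$) satisfy $\|f'(x)\|_*\le L$, $L>0$. $f^*=\min_Qf$. Stochastic oracle: $(\Omega,\mathcal F,P)$ is a probability space with a filtration $(\mathcal F_t)_{t\ge-1}$, $\mathcal F_{-1}$ being trivial, and $\mathbf E_{t}$ is the conditional expectation given $\mathcal F_{t}$. Number consecutively by $t=0,1,\dots$ all oracle calls made over all stages of the procedure. At call $t$ the oracle is queried at a point $X_t\in Q$ which is $\mathcal F_{t-1}$-measurable and returns an $\mathcal F_t$-measurable random vector $g_t\in E^*$. Unbiasedness: $\mathbf E_{t-1}[g_t]=f'(X_t)\in\partial f(X_t)$ a.s. The noise is $\xi_t=g_t-f'(X_t)$. Prox-function: $d:B\to\mathbb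 R$ is continuous, $d(x)\ge d(0)=0$ on $B$, and strongly convex with parameter $\mu(d)>0$: $d(\alpha x+(1-\alpha)y)\le\alpha d(x)+(1-\alpha)d(y)-\frac12\mu(d)\alpha(1-\alpha)\|x-y\|^2$. Quadratic growth: $C(d)<\infty$ is the smallest $C$ with $d(x)\le C\|x\|^2$ for $x\in B$. For $z\in Q$, $R>0$, $\beta>0$: $Q_R(z)=Q\cap B_R(z)$, $d_{z,R}(x)=d\left(\frac1R(x-z)\right)$, $\pi_{z,R,\beta}(s)=\arg\max\{\langle s,x-z\rangle-\beta d_{z,R}(x):x\in Q_R(z)\}$. Stochastic dual averaging method with parameter $\gamma>0$, center $\bar x\in Q$, radius $R>0$, and $N\ge0$ iterations: put $\beta=\gamma\sqrt{N+1}$, $x_0=\bar x$, $s_0=0$, and for $k=0,1,\dots,N-1$: $s_{k+1}=s_k+g_k$, where $g_k$ is the (new) oracle answer at $x_k$, and $x_{k+1}=\pi_{\bar x,R,\beta}(-s_{k+1})$. Output: $x_N(\bar x,R)=\frac1{N+1}\sum_{i=0}^Nx_i$. *)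

(* Defs.v *)
From HB Require Import structures.
From mathcomp Require Import all_boot all_order all_algebra.
From mathcomp Require Import all_classical all_reals all_analysis.

Set Implicit Arguments.
Unset Strict Implicit.
Unset Printing Implicit Defensive.

Import Order.TTheory GRing.Theory Num.Theory.
Import numFieldNormedType.Exports.

Local Open Scope classical_set_scope.
Local Open Scope ring_scope.

#[short(type="normedVectType")]
HB.structure Definition NormedVector (K : numFieldType) :=
  {V of NormedModule K V & Vector K V}.

Section Geometry.
Context {R : realType} {E : normedVectType R}.
Implicit Types (A Q : set E) (f d : E -> R) (s : 'Hom(E, R^o)) (z x y : E).

(* All vectors at distance at most r from z. *)
Definition cball z (r : R) : set E := [set y | `|y - z| <= r].

Definition dual_norm s : R := sup [set (s x : R) | x in cball 0 1].

Definition dual_open (U : set 'Hom(E, R^o)) : Prop :=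
  forall s, U s -> exists2 e : R, 0 < e &
    forall t : 'Hom(E, R^o), dual_norm (t - s) < e -> U t.

Definition diameter A : R := sup [set `|x - y| | x in A & y in A].

Definition is_min f Q (v : R) : Prop :=
  (exists2 x, Q x & f x = v) /\ (forall x, Q x -> v <= f x).

Definition uniformly_convex Q f (rho mu : R) : Prop :=
  forall x y (a : R), Q x -> Q y -> 0 <= a <= 1 ->
    f (a *: x + (1 - a) *: y) <=
      a * f x + (1 - a) * f y
      - 2^-1 * mu * a * (1 - a)
        * (a `^ (rho - 1) + (1 - a) `^ (rho - 1)) * `|x - y| `^ rho.

Definition strongly_convex Q f (mu : R) : Prop :=
  forall x y (a : R), Q x -> Q y -> 0 <= a <= 1 ->
    f (a *: x + (1 - a) *: y) <=
      a * f x + (1 - a) * f y - 2^-1 * mu * a * (1 - a) * `|x - y| ^+ 2.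

Definition subdifferential Q f x : set 'Hom(E, R^o) :=
  [set s | forall y, Q y -> f x + s (y - x) <= f y].

Definition prox_function d (mu : R) : Prop :=
  [/\ {within cball 0 1, continuous d}, d 0 = 0,
      (forall x, cball 0 1 x -> 0 <= d x) & strongly_convex (cball 0 1) d mu].

Definition quadratic_growth_constant d (C : R) : Prop :=
  (forall x, cball 0 1 x -> d x <= C * `|x| ^+ 2) /\
  (forall C' : R,
    (forall x, cball 0 1 x -> d x <= C' * `|x| ^+ 2) -> C <= C').

Definition scaled_prox d z (r : R) x : R := d (r^-1 *: (x - z)).

(* The maximizer exists and is unique when Q is closed and convex, z \in Q,
   r, beta > 0 and d is a prox-function; otherwise the choice is arbitrary. *)
Definition prox_map Q d z (r beta : R) s : E :=
  get [set x | (Q `&` cball z r) x /\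
    forall y, (Q `&` cball z r) y ->
      s (y - z) - beta * scaled_prox d z r y <=
      s (x - z) - beta * scaled_prox d z r x].

(* The k-th point of a run of at most n iterations, a i being the oracle answer
   obtained at the i-th point. *)
Definition sda_point Q d (gamma : R) z (r : R) (n : nat)
    (a : nat -> 'Hom(E, R^o)) (k : nat) : E :=
  if k is 0%N then z
  else prox_map Q d z r (gamma * Num.sqrt n.+1%:R) (- \sum_(i < k) a i).

Definition sda_output Q d (gamma : R) z (r : R) (n : nat)
    (a : nat -> 'Hom(E, R^o)) : E :=
  n.+1%:R^-1 *: \sum_(i < n.+1) sda_point Q d gamma z r n a i.

End Geometry.

Section Multistage.
Context {R : realType} {E : normedVectType R}.
Variables (Q : set E) (d : E -> R) (mud Cd L sigma R0 : R).
Variables (x0 : E) (n : nat).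

(* The weight of the (k+1)-st stage, whose localization radius is R0 / 2 ^ k. *)
Definition stage_gamma (k : nat) : R :=
  R0 ^+ 2 / (R0 / 2 ^+ k)
  * Num.sqrt ((L ^+ 2 + sigma ^+ 2) / (2 * Cd * mud)).

(* y_k, when stages have n iterations each and a t is the t-th oracle answer:
   stage k + 1 consumes the answers number k * n, ..., k * n + n - 1. *)
Fixpoint stage_center (a : nat -> 'Hom(E, R^o)) (k : nat) : E :=
  if k is j.+1 then
    sda_output Q d (stage_gamma j) (stage_center a j) R0 n
      (fun i => a (j * n + i)%N)
  else x0.

(* The point at which the t-th oracle call is made. *)
Definition query_point (a : nat -> 'Hom(E, R^o)) (t : nat) : E :=
  let k := (t %/ n)%N in
  sda_point Q d (stage_gamma k) (stage_center a k) R0 n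
    (fun i => a (k * n + i)%N) (t %% n)%N.

End Multistage.

Section Oracle.
Context {R : realType} {E : normedVectType R} {disp : measure_display}
  {Omega : measurableType disp}.
Variable P : probability Omega R.

(* O is a topology on T, and G a sigma-algebra. *)
Definition borel_measurable (G : set (set Omega)) (T : Type) (O : set (set T))
    (X : Omega -> T) : Prop :=
  forall U, <<s O >> U -> G (X @^-1` U).

(* F t stands for the sigma-algebra with index t - 1. *)
Definition filtration (F : nat -> set (set Omega)) : Prop :=
  [/\ forall t, sigma_algebra setT (F t),
      forall t, F t `<=` measurable &
      forall s t, (s <= t)%N -> F s `<=` F t].

Definition is_cond_exp (G : set (set Omega)) (X Y : Omega -> R) : Prop :=
  [/\ P.-integrable setT (EFin \o X), P.-integrable setT (EFin \o Y),
      borel_measurable G open Y &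
      forall A, G A ->
        (\int[P]_(w in A) (Y w)%:E = \int[P]_(w in A) (X w)%:E)%E].

Definition is_dual_cond_exp (G : set (set Omega))
    (X Y : Omega -> 'Hom(E, R^o)) : Prop :=
  forall v : E, is_cond_exp G (fun w => X w v) (fun w => Y w v).

(* With the index shift of the filtration, query points are F t-measurable,
   answers are F t.+1-measurable, and the conditioning is on F t. *)
Definition unbiased_oracle (Q : set E) (f : E -> R) (f' : E -> 'Hom(E, R^o))
    (F : nat -> set (set Omega)) (X : nat -> Omega -> E)
    (g : nat -> Omega -> 'Hom(E, R^o)) (T : nat) : Prop :=
  forall t, (t < T)%N ->
    [/\ forall w, Q (X t w),
        borel_measurable (F t) open (X t),
        borel_measurable (F t.+1) dual_open (g t) &
        exists2 Y, is_dual_cond_exp (F t) (g t) Y &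
          {ae P, forall w,
            Y w = f' (X t w) /\ subdifferential Q f (X t w) (f' (X t w))}].

End Oracle.

Definition log2 {R : realType} (x : R) : R := ln x / ln 2.

(* Main.v *)
(* Within a stage, the prox objective is strongly concave, so the values of its
   successive maxima telescope to a regret bound for the answers; in mean it
   gives, for an adapted comparator x and the stage radius r = R0 / 2 ^ k,
     E f(y_{k+1}) - E f(x) <= kappa / 2 * (E |x - y_k|^2 / r + 2 r),
   where kappa = sqrt (C(d) (L^2 + sigma^2) log_2 N / (mu(d) N)).  While r is
   above r* = 2 (6 kappa / mu(f))^(1 / (rho - 1)), uniform convexity turns
   E f(y_k) - f^* <= 3 kappa r into E |x^* - y_k|^2 <= r^2, so the comparator x^*
   propagates the bound to the next stage, with half the radius.  Once r < r*,
   the comparator x = y_k shows that the mean value increases by at most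
   kappa r per stage, and these increments form a geometric series. *)

Require Import Defs.
From HB Require Import structures.
From mathcomp Require Import all_boot all_order all_algebra.
From mathcomp Require Import all_classical all_reals all_analysis.
From mathcomp Require Import measurable_realfun ring lra.

Set Implicit Arguments.
Unset Strict Implicit.
Unset Printing Implicit Defensive.

Import Order.TTheory GRing.Theory Num.Theory.
Import numFieldNormedType.Exports.

Local Open Scope classical_set_scope.
Local Open Scope ring_scope.

(** Being close to the minimizer is known only in mean, so no stage may cut [Q] down: every prox
    step uses the radius [R0], and the shrinking radius enters through the weight [gamma] alone.
    Uniform convexity controls the power [rho] of the distance while a stage needs its square; the
    tangent of a concave function carries the first into the second and, being affine, passes to
    means. Measurability is the technical obstacle. [f'] is an arbitrary selection of subgradients,
    and the final output is never queried, so it is not assumed measurable. Mean bounds are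
    therefore stated through integrable functions that dominate almost everywhere. In terms of
    [kappa], the claimed rate is [16 * kappa * (4 * kappa / muf) ^ (1 / (rho - 1))]. If the radii
    never fall below [r*], the final bound [3 * kappa * R0 / 2 ^ m] must be compared with this rate
    directly. That uses the choice of [m], which gives [2 ^ - m <= 4 * kappa / sqrt (L ^ 2 + sigma ^
    2)], and a bound on [R0] by [L] and [muf], forced by uniform convexity together with bounded
    subgradients. *)

(** * Norm equivalence, compactness and the dual norm in finite dimension *)

Section FiniteDimension.
Import passmx.
Context {R : realType} {E : normedVectType R}.
Implicit Types (x y v : E) (s t : 'Hom(E, R^o)).

Local Notation n := (\dim {:E}).
Local Notation e := (vbasis {:E}).
Local Notation vec := (@vecof R E e).
Local Notation row := (@rVof R E e).

Let e_basis : basis_of {:E} e := vbasisP _.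

Lemma norm_rV_coord m (v : 'rV[R]_m) i : `|v 0 i| <= `|v|.
Proof.
have /mapP[j Hj ->] : `|v ord0 i| \in [seq `|v x.1 x.2| | x : 'I_1 * 'I_m].
  by apply/mapP; exists (ord0, i) => //=; rewrite mem_enum.
by rewrite [leRHS]/Num.norm /= mx_normrE; apply/bigmax_geP; right => /=; exists j.
Qed.

Lemma vecof_bounded (v : 'rV[R]_n) : `|vec v| <= (\sum_(i < n) `|e`_i|) * `|v|.
Proof.
rewrite /vecof (le_trans (ler_norm_sum _ _ _))// mulr_suml ler_sum//.
by move=> i _; rewrite normrZ mulrC ler_wpM2l// norm_rV_coord.
Qed.

Lemma vecof_continuous : continuous vec.
Proof.
apply: (@bounded_linear_continuous _ _ _ vec); apply/bounded_funP => r.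
exists ((\sum_(i < n) `|e`_i|) * r) => v vr.
by rewrite (le_trans (vecof_bounded _))// ler_wpM2l// sumr_ge0.
Qed.

(** The norm read in coordinates is continuous, hence attains a positive minimum on the compact unit
    sphere of row vectors, and homogeneity does the rest. Compactness in [E] and continuity of
    linear forms both come from here. *)
Lemma vecof_lower_bound :
  exists2 c : R, 0 < c & forall v : 'rV[R]_n, c * `|v| <= `|vec v|.
Proof.
pose S := [set v : 'rV[R]_n | `|v| = 1].
have normc : continuous (fun v : 'rV[R]_n => `|vec v|).
  by move=> v; apply: (@continuous_comp _ _ _ vec);
    [exact: vecof_continuous|exact: norm_continuous].
(* An empty sphere means dimension zero, where 0 is the only vector. *)
have [S0|S0] := pselect (S !=set0); last first.
  exists 1 => // v; have [->|v0] := eqVneq v 0; first by rewrite normr0 mulr0.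
  case: S0; exists (`|v|^-1 *: v); rewrite /S/= normrZ ger0_norm ?invr_ge0//.
  by rewrite mulVf// normr_eq0.
have Scomp : compact S.
  apply: bounded_closed_compact.
    by exists 1; split=> // r r1 v /= ->; exact: ltW.
  apply: (@preimage_closed _ _ (fun v : 'rV[R]_n => `|v|) [set 1]).
    by move=> v _; exact: norm_continuous.
  exact: closed_eq.
have [c /set_mem Sc cmin] := compact_EVT_min S0 Scomp
  (continuous_subspaceT normc).
have c_gt0 : 0 < `|vec c|.
  rewrite normr_gt0 vecof_eq0//.
  apply/eqP => c0; move: Sc; rewrite /S/= c0 normr0 => /esym/eqP.
  by rewrite oner_eq0.
exists (`|vec c|) => // v.
have [->|v0] := eqVneq v 0; first by rewrite normr0 mulr0.
have nv : 0 < `|v| by rewrite normr_gt0.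
have := cmin (`|v|^-1 *: v); rewrite inE /S/= normrZ ger0_norm ?invr_ge0//.
rewrite mulVf ?gt_eqF// => /(_ erefl).
by rewrite linearZ/= normrZ ger0_norm ?invr_ge0// ler_pdivlMl// mulrC.
Qed.

Lemma coord_bounded :
  exists2 M : R, 0 <= M & forall i x, `|coord e i x| <= M * `|x|.
Proof.
have [c c0 cP] := vecof_lower_bound; exists c^-1; first by rewrite invr_ge0 ltW.
move=> i x; rewrite coord_rVof -ler_pdivrMl ?invr_gt0// invrK.
rewrite -[in leRHS](rVofK e_basis x) (le_trans _ (cP _))//.
by rewrite ler_wpM2l ?(ltW c0)//; exact: norm_rV_coord.
Qed.

Lemma coord_sum x : x = \sum_i coord e i x *: e`_i.
Proof. by rewrite -coord_vbasis ?memvf. Qed.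

Lemma lfun_coord s x : s x = \sum_i coord e i x * s e`_i.
Proof.
by rewrite {1}(coord_sum x) linear_sum; apply: eq_bigr => i _; rewrite linearZ.
Qed.

Lemma lfun_bounded s : exists2 M : R, 0 <= M & forall x, `|s x| <= M * `|x|.
Proof.
have [M M0 cM] := coord_bounded.
exists (\sum_(i < n) M * `|s e`_i|).
  by apply: sumr_ge0 => i _; rewrite mulr_ge0.
move=> x; rewrite lfun_coord (le_trans (ler_norm_sum _ _ _))//.
rewrite mulr_suml ler_sum//.
by move=> i _; rewrite normrM mulrAC ler_wpM2r.
Qed.

Lemma cball01 x : cball (0 : E) 1 x = (`|x| <= 1).
Proof. by rewrite /cball/= subr0. Qed.

(** A real [sup] carries information only for a nonempty set bounded above. *)
Let has_sup_dual s : has_sup [set (s x : R) | x in cball (0 : E) 1].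
Proof.
split; first by exists (s 0), 0 => //; rewrite cball01 normr0.
have [M M0 sM] := lfun_bounded s.
exists M => _ [x + <-]; rewrite cball01 => x1.
by rewrite (le_trans (ler_norm _))// (le_trans (sM _))// ler_piMr.
Qed.

Lemma dual_norm_ge0 s : 0 <= dual_norm s.
Proof.
apply: (sup_upper_bound (has_sup_dual s)); exists 0; last exact: linear0.
by rewrite cball01 normr0.
Qed.

Lemma dual_normP s x : s x <= dual_norm s * `|x|.
Proof.
have [->|x0] := eqVneq x 0; first by rewrite linear0 normr0 mulr0.
have nx : 0 < `|x| by rewrite normr_gt0.
rewrite mulrC -ler_pdivrMl//.
apply: (sup_upper_bound (has_sup_dual s)); exists (`|x|^-1 *: x).
  by rewrite cball01 normrZ ger0_norm ?invr_ge0// mulVf// gt_eqF.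
by rewrite linearZ.
Qed.

Lemma dual_norm_le s (M : R) :
  (forall x, `|x| <= 1 -> s x <= M) -> dual_norm s <= M.
Proof.
move=> sM; apply: ge_sup; first by case: (has_sup_dual s).
by move=> _ [x + <-]; rewrite cball01 => /sM.
Qed.

Lemma dual_normD s t : dual_norm (s + t) <= dual_norm s + dual_norm t.
Proof.
apply: dual_norm_le => x x1; rewrite add_lfunE lerD//;
  by rewrite (le_trans (dual_normP _ _))// ler_piMr// dual_norm_ge0.
Qed.

Lemma dual_normP_abs s x : `|s x : R| <= dual_norm s * `|x|.
Proof.
rewrite ler_norml lerNl dual_normP andbT -[- s x]linearN.
by rewrite (le_trans (dual_normP _ _))// normrN.
Qed.

(** Heine-Borel transported from coordinates: [vec] is continuous and onto, and its lower bound
    keeps preimages of bounded sets bounded. *)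
Lemma closed_bounded_compact (Q : set E) :
  closed Q -> bounded_set Q -> compact Q.
Proof.
move=> Qc Qb; have -> : Q = vec @` (vec @^-1` Q).
  apply/seteqP; split => [x Qx|_ [v Qv <-]//].
  by exists (row x); rewrite /= rVofK.
apply: continuous_compact.
  exact/continuous_subspaceT/vecof_continuous.
apply: bounded_closed_compact; last first.
  by apply: preimage_closed => // v _; exact: vecof_continuous.
have [c c0 cP] := vecof_lower_bound.
have [M M0 QM] := ex_strict_bound_gt0 Qb.
exists (c^-1 * M); split=> [|r Mr v /= Qv]; first exact: num_real.
by rewrite (le_trans _ (ltW Mr))// ler_pdivlMl// (le_trans (cP v))// ltW// QM.
Qed.

Lemma lfun_continuous s : continuous (s : E -> R^o).
Proof.
apply: (@bounded_linear_continuous _ E R^o s); apply/bounded_funP => r.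
have [M M0 sM] := lfun_bounded s.
exists (M * r) => x xr.
by rewrite (le_trans (sM x))// ler_wpM2l.
Qed.

Lemma coord_continuous i : continuous (fun x => coord e i x : R).
Proof.
pose c := linfun (coord e i : E -> R^o).
have -> : (fun x => coord e i x) = (c : E -> R^o).
  by apply/funext => x; rewrite lfunE.
exact: lfun_continuous.
Qed.

End FiniteDimension.

(** * Pathwise analysis of one dual averaging stage *)

Section DualAveraging.
Context {R : realType} {E : normedVectType R}.
Variables (Q : set E) (d : E -> R) (mud : R).
Hypotheses (Q_closed : closed Q) (Q_bounded : bounded_set Q).
Hypothesis Q_convex : convex_set (Q : set (convex_lmodType E)).
Hypotheses (mud_gt0 : 0 < mud) (d_prox : prox_function d mud).
Implicit Types (s : 'Hom(E, R^o)) (x y z : E) (a : nat -> 'Hom(E, R^o)).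

Lemma convex_comb x y (p : R) :
  Q x -> Q y -> 0 <= p <= 1 -> Q (p *: x + (1 - p) *: y).
Proof.
move=> Qx Qy /andP[p0 p1].
have p01 : Itv.spec (@Itv.num_sem R)
    (Itv.Real (Interval (BLeft 0%Z) (BRight 1%Z))) p.
  by rewrite /Itv.spec/= /Itv.num_sem/= num_real in_itv/= p0 p1.
have /set_mem := @Q_convex x y (Itv.mk p01) (mem_set Qx) (mem_set Qy).
by [].
Qed.

Lemma convex_average n (x : nat -> E) : (forall i, Q (x i)) ->
  Q (n.+1%:R^-1 *: \sum_(i < n.+1) x i).
Proof.
move=> Qx; elim: n => [|n IH]; first by rewrite big_ord1 invr1 scale1r.
rewrite big_ord_recr/= scalerDr.
pose p : R := n.+1%:R / n.+2%:R.
have n2 : n.+2%:R != 0 :> R by rewrite pnatr_eq0.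
have p1 : 1 - p = n.+2%:R^-1.
  by rewrite /p -{1}(divff n2) -mulrBl -natrB// subSnn mul1r.
have -> : n.+2%:R^-1 *: \sum_(i < n.+1) x i =
    p *: (n.+1%:R^-1 *: \sum_(i < n.+1) x i).
  by rewrite scalerA /p mulrAC mulfV ?pnatr_eq0// mul1r.
rewrite -p1; apply: convex_comb => //.
by rewrite /p divr_ge0//= ler_pdivrMr// mul1r ler_nat.
Qed.

Definition prox_objective z (r beta : R) s x : R :=
  s (x - z) - beta * scaled_prox d z r x.

Definition prox_maximizer z (r beta : R) s x : Prop :=
  (Q `&` cball z r) x /\
  forall y, (Q `&` cball z r) y ->
    prox_objective z r beta s y <= prox_objective z r beta s x.

Let cball_scaled z (r : R) x : 0 < r -> cball z r x ->
  cball 0 1 (r^-1 *: (x - z)).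
Proof.
move=> r0 xz; rewrite cball01 normrZ ger0_norm ?invr_ge0 ?(ltW r0)//.
by rewrite ler_pdivrMl// mulr1.
Qed.

Lemma scaled_prox_continuous z (r : R) : 0 < r ->
  {within Q `&` cball z r, continuous (scaled_prox d z r)}.
Proof.
move=> r0; have [/subspace_continuousP dc _ _ _] := d_prox.
apply/subspace_continuousP => x [Qx xz].
have phic : (fun y => r^-1 *: (y - z)) @ x --> r^-1 *: (x - z).
  apply: cvgZr; apply: cvgB; [exact: cvg_id|exact: cvg_cst].
apply: cvg_trans (dc _ (cball_scaled r0 xz)) => U.
rewrite !nbhs_filterE /= => HU.
have := phic _ HU; rewrite /within /nbhs/=; apply: filterS => y /= yU [Qy yz].
exact: yU (cball_scaled r0 yz).
Qed.

(** A continuous objective attains its maximum on a nonempty compact set, so the choice made by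
    [get] is a genuine maximizer. *)
Lemma prox_mapP z (r beta : R) s : Q z -> 0 < r ->
  prox_maximizer z r beta s (prox_map Q d z r beta s).
Proof.
move=> Qz r0; rewrite /prox_map.
have cballc : closed (cball z r).
  apply: (@preimage_closed _ _ (fun y => `|y - z|) [set t | t <= r]).
    move=> y _; apply: (@continuous_comp _ _ _ (fun y => y - z)).
      by apply: cvgB; [exact: cvg_id|exact: cvg_cst].
    exact: norm_continuous.
  exact: closed_le.
have QRcomp : compact (Q `&` cball z r).
  apply: closed_bounded_compact; first exact: closedI.
  have [M [Mr QM]] := Q_bounded.
  by exists M; split=> // t Mt x [Qx _]; exact: QM.
have QR0 : Q `&` cball z r !=set0.
  by exists z; split=> //; rewrite /cball/= subrr normr0 ltW.
have objc : {within Q `&` cball z r, continuous (prox_objective z r beta s)}.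
  have sc : {within Q `&` cball z r, continuous (fun y => s (y - z) : R)}.
    apply: continuous_subspaceT => y.
    apply: (@continuous_comp _ _ _ (fun y => y - z)); last exact: lfun_continuous.
    by apply: cvgB; [exact: cvg_id|exact: cvg_cst].
  move=> y; apply: cvgB; first exact: sc.
  by apply: cvgM; [exact: cvg_cst|exact: scaled_prox_continuous].
have [x /set_mem Hx xmax] := compact_EVT_max QR0 QRcomp objc.
by apply: getI (x) _; split => // y Hy; apply: xmax; rewrite inE.
Qed.

(** A point at parameter [p] on the segment from [x] to [y] cannot beat [x]. Strong concavity,
    divided by [p], leaves the gap up to a factor [1 - p], and [p] tends to 0. *)
Lemma prox_map_gap z (r beta : R) s x y : 0 < r -> 0 < beta ->
  prox_maximizer z r beta s x -> (Q `&` cball z r) y ->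
  prox_objective z r beta s y + beta * mud / (2 * r ^+ 2) * `|y - x| ^+ 2
  <= prox_objective z r beta s x.
Proof.
move=> r0 b0 [[Qx xz] xmax] [Qy yz].
set K := beta * mud / (2 * r ^+ 2) * `|y - x| ^+ 2.
have K0 : 0 <= K.
  by rewrite mulr_ge0 ?exprn_ge0// divr_ge0 ?mulr_ge0 ?exprn_ge0 ?ltW.
have step (p : R) : 0 < p <= 1 -> prox_objective z r beta s y + (1 - p) * K
    <= prox_objective z r beta s x.
  move=> /andP[p0 p1].
  pose w := p *: y + (1 - p) *: x.
  have wz : w - z = p *: (y - z) + (1 - p) *: (x - z).
    rewrite /w !scalerBr addrACA -opprD -scalerDl.
    by rewrite [X in X *: z](_ : _ = 1) ?scale1r//; ring.
  have QRw : (Q `&` cball z r) w.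
    split; first by apply: convex_comb => //; rewrite ltW.
    rewrite /cball/= wz (le_trans (ler_normD _ _))// !normrZ.
    rewrite (ger0_norm (ltW p0)) ger0_norm ?subr_ge0//.
    move: xz yz; rewrite /cball/= => xz yz.
    have -> : r = p * r + (1 - p) * r by ring.
    by rewrite lerD// ler_wpM2l ?subr_ge0 ?(ltW p0).
  have := xmax w QRw.
  have [_ _ _ dsc] := d_prox.
  have p01 : 0 <= p <= 1 by rewrite ltW.
  have := dsc _ _ p (cball_scaled r0 yz) (cball_scaled r0 xz) p01.
  have -> : p *: (r^-1 *: (y - z)) + (1 - p) *: (r^-1 *: (x - z)) =
      r^-1 *: (p *: (y - z) + (1 - p) *: (x - z)).
    by rewrite [RHS]scalerDr !scalerA (mulrC p) (mulrC (1 - p)).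
  have -> : r^-1 *: (y - z) - r^-1 *: (x - z) = r^-1 *: (y - x).
    by rewrite -scalerBr opprB addrA subrK.
  have sw : s (p *: (y - z) + (1 - p) *: (x - z)) =
      p * s (y - z) + (1 - p) * s (x - z) :> R.
    by rewrite linearD !linearZ.
  rewrite /prox_objective /scaled_prox wz sw.
  rewrite normrZ ger0_norm ?invr_ge0 ?(ltW r0)//.
  set Dw := d (_ *: (p *: _ + _)); set Dy := d (_ *: (y - z)); set Dx := d _.
  set Sy := s (y - z); set Sx := s (x - z).
  move=> dineq maxineq.
  have KE : beta * (2^-1 * mud * p * (1 - p) * (r^-1 * `|y - x|) ^+ 2) =
      p * ((1 - p) * K).
    by rewrite /K; field; exact: lt0r_neq0.
  have bD := ler_wpM2l (ltW b0) dineq; rewrite (mulrBr beta) KE in bD.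
  rewrite -(ler_pM2l p0) ; nra.
apply/ler_addgt0Pr => eps eps0.
(* The limit made explicit: this [p] satisfies [p * K <= eps]. *)
pose p := eps / (K + eps).
have Ke : 0 < K + eps by rewrite ltr_wpDl.
have := step p; rewrite /p divr_gt0//= ler_pdivrMr// mul1r lerDr K0 => /(_ isT).
have : eps / (K + eps) * K <= eps.
  by rewrite mulrAC ler_pdivrMr// ler_wpM2l ?lerDl ?ltW.
lra.
Qed.

(** The starting point fits the pattern: for the zero functional the objective is [- beta * d]
    rescaled, maximal at the center since [d] is nonnegative and vanishes at 0. Telescoping can thus
    begin at [k = 0]. *)
Lemma sda_pointP (gamma : R) z (r : R) n a k : Q z -> 0 < r -> 0 < gamma ->
  prox_maximizer z r (gamma * Num.sqrt n.+1%:R) (- \sum_(i < k) a i)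
    (sda_point Q d gamma z r n a k).
Proof.
move=> Qz r0 g0; case: k => [|k]; last exact: prox_mapP.
rewrite big_ord0 oppr0 /=; split.
  by split=> //; rewrite /cball/= subrr normr0 ltW.
have [_ d0 dge0 _] := d_prox.
move=> y [Qy yz]; rewrite /prox_objective !zero_lfunE /scaled_prox.
rewrite subrr scaler0 d0 mulr0 subr0 sub0r oppr_le0 mulr_ge0//.
  by rewrite mulr_ge0 ?sqrtr_ge0// ltW.
exact/dge0/cball_scaled.
Qed.

Lemma sda_point_in (gamma : R) z (r : R) n a k : Q z -> 0 < r -> 0 < gamma ->
  Q (sda_point Q d gamma z r n a k).
Proof. by move=> Qz r0 g0; have [[]] := sda_pointP n a k Qz r0 g0. Qed.

Lemma sda_output_in (gamma : R) z (r : R) n a : Q z -> 0 < r -> 0 < gamma ->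
  Q (sda_output Q d gamma z r n a).
Proof.
by move=> Qz r0 g0; apply: convex_average => i; exact: sda_point_in.
Qed.

Lemma sda_point_ext (gamma : R) z (r : R) n a b k :
  (forall i, (i < k)%N -> a i = b i) ->
  sda_point Q d gamma z r n a k = sda_point Q d gamma z r n b k.
Proof.
case: k => // k ab /=; congr (prox_map _ _ _ _ _ (- _)).
by apply: eq_bigr => i _; exact: ab.
Qed.

(* The maximal value [V k] of the prox objective at the k-th partial sum obeys
   [V k.+1 <= V k - a k (x k - z) + |a k|^2 / (2 c)], by the strong concavity
   of the objective at its maximizer; the regret bound is the telescoped sum. *)
Lemma sda_regret (gamma : R) z (r : R) n a m x :
  let beta := gamma * Num.sqrt n.+1%:R in
  let X := sda_point Q d gamma z r n a in
  Q z -> 0 < r -> 0 < gamma -> (Q `&` cball z r) x ->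
  \sum_(i < m) (a i (X i - x) : R) <= beta * scaled_prox d z r x
    + r ^+ 2 / (2 * beta * mud) * \sum_(i < m) dual_norm (a i) ^+ 2.
Proof.
move=> beta X Qz r0 g0 QRx.
have b0 : 0 < beta by rewrite mulr_gt0// sqrtr_gt0.
pose S k := - \sum_(i < k) a i.
pose V k := prox_objective z r beta (S k) (X k).
have XP k : prox_maximizer z r beta (S k) (X k) by exact: sda_pointP.
have V0 : V 0%N = 0.
  rewrite /V /prox_objective /S big_ord0 oppr0 zero_lfunE /scaled_prox /X /=.
  by have [_ d0 _ _] := d_prox; rewrite subrr scaler0 d0 mulr0 subr0.
have VS k : V k.+1 <= V k - a k (X k - z)
    + r ^+ 2 / (2 * beta * mud) * dual_norm (a k) ^+ 2.
  have [QX _] := XP k.+1.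
  have := prox_map_gap r0 b0 (XP k) QX.
  have SE (w : E) : S k.+1 w = S k w - a k w :> R.
    by rewrite /S big_ord_recr/= opprD add_lfunE (opp_lfunE (a k)).
  rewrite /V /prox_objective SE.
  have -> : a k (X k.+1 - z) = a k (X k - z) - a k (X k - X k.+1) :> R.
    by rewrite -[RHS]linearB; congr (a k _); rewrite opprB [RHS]addrC addrA subrK.
  have := dual_normP (a k) (X k - X k.+1); rewrite distrC.
  set u := `|_|; set A := dual_norm _ => Au.
  (* Young's inequality, weighted so that the term in [u] is exactly the strong concavity gap. *)
  have : A * u <= beta * mud / (2 * r ^+ 2) * u ^+ 2
      + r ^+ 2 / (2 * beta * mud) * A ^+ 2.
    rewrite -subr_ge0.
    have -> : beta * mud / (2 * r ^+ 2) * u ^+ 2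
        + r ^+ 2 / (2 * beta * mud) * A ^+ 2 - A * u =
      (beta * mud * u - r ^+ 2 * A) ^+ 2 / (2 * r ^+ 2 * beta * mud).
      by field; rewrite !lt0r_neq0.
    rewrite divr_ge0 ?exprn_even_ge0// !mulr_ge0 ?exprn_ge0 ?ltW//.
  lra.
have Vm k : V k <= - \sum_(i < k) (a i (X i - z) : R)
    + r ^+ 2 / (2 * beta * mud) * \sum_(i < k) dual_norm (a i) ^+ 2.
  elim: k => [|k IH]; first by rewrite V0 !big_ord0 oppr0 mulr0 addr0.
  by rewrite !big_ord_recr/=; have := VS k; lra.
have [_ /(_ x QRx)] := XP m; rewrite -/(V m) => /le_trans/(_ (Vm m)).
rewrite /prox_objective /S opp_lfunE sum_lfunE.
have -> : \sum_(i < m) (a i (X i - x) : R) =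
    \sum_(i < m) (a i (X i - z) : R) - \sum_(i < m) (a i (x - z) : R).
  rewrite -sumrB; apply: eq_bigr => i _.
  by rewrite -linearB opprB addrA subrK.
set b1 := \sum_(i < m) _ (x - z).
lra.
Qed.

(** The subgradient at the average point plays the part of Jensen's inequality: its linear terms sum
    to zero. The subgradients at the individual points then give the comparison with [x]. *)
Lemma subgradient_average (f : E -> R) (f' : E -> 'Hom(E, R^o)) n
    (X : nat -> E) x :
  (forall u, Q u -> subdifferential Q f u (f' u)) -> (forall i, Q (X i)) ->
  Q x ->
  n.+1%:R * (f (n.+1%:R^-1 *: \sum_(i < n.+1) X i) - f x) <=
    \sum_(i < n.+1) (f' (X i) (X i - x) : R).
Proof.
move=> f'P QX Qx; set w := _ *: _.
have Qw : Q w by exact: convex_average.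
apply: (@le_trans _ _ (\sum_(i < n.+1) (f (X i) - f x))).
  have : \sum_(i < n.+1) (f w + f' w (X i - w)) <= \sum_(i < n.+1) f (X i).
    by apply: ler_sum => i _; exact: f'P.
  have -> : \sum_(i < n.+1) (f w + f' w (X i - w) : R) = n.+1%:R * f w.
    rewrite big_split/= sumr_const card_ord -[f w *+ _]mulr_natl -[RHS]addr0.
    congr (_ + _).
    transitivity (f' w (\sum_(i < n.+1) (X i - w)) : R).
      by rewrite linear_sum.
    rewrite sumrB sumr_const card_ord.
    rewrite -scaler_nat /w scalerA mulfV ?pnatr_eq0// scale1r subrr.
    exact: linear0.
  rewrite sumrB sumr_const card_ord -[f x *+ _]mulr_natl; lra.
apply: ler_sum => i _; have := f'P _ (QX i) x Qx.
by rewrite -opprB linearN/=; lra.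
Qed.

(* The last point of a stage is never queried, so the regret bound is applied
   to the answers completed by the subgradient at that point. *)
Lemma sda_output_bound (f : E -> R) (f' : E -> 'Hom(E, R^o)) (L C gamma : R)
    z (r : R) n a x :
  let beta := gamma * Num.sqrt n.+1%:R in
  let X := sda_point Q d gamma z r n a in
  (forall u, Q u -> subdifferential Q f u (f' u) /\ dual_norm (f' u) <= L) ->
  (forall u, cball 0 1 u -> d u <= C * `|u| ^+ 2) ->
  Q z -> 0 < r -> 0 < gamma -> (Q `&` cball z r) x ->
  n.+1%:R * (f (sda_output Q d gamma z r n a) - f x) <=
    beta * (C * (`|x - z| ^+ 2 / r ^+ 2))
    + r ^+ 2 / (2 * beta * mud) * (L ^+ 2 + \sum_(i < n) dual_norm (a i) ^+ 2)
    + \sum_(i < n) ((f' (X i) - a i) (X i - x) : R).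
Proof.
move=> beta X f'P dC Qz r0 g0 QRx.
have b0 : 0 < beta by rewrite mulr_gt0// sqrtr_gt0.
pose b i := if (i < n)%N then a i else f' (X n).
have QX i : Q (X i) by exact: sda_point_in.
have Xb i : (i <= n)%N -> sda_point Q d gamma z r n b i = X i.
  move=> ni; apply: sda_point_ext => j ji; rewrite /b.
  by rewrite (leq_trans ji).
have := @sda_regret gamma z r n b n.+1 x Qz r0 g0 QRx.
have -> : \sum_(i < n.+1) (b i (sda_point Q d gamma z r n b i - x) : R) =
    \sum_(i < n) (a i (X i - x) : R) + f' (X n) (X n - x).
  rewrite big_ord_recr/= Xb// /b ltnn; congr (_ + _).
  by apply: eq_bigr => i _; rewrite Xb ?(ltnW (ltn_ord _))// ltn_ord.
have -> : \sum_(i < n.+1) dual_norm (b i) ^+ 2 =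
    \sum_(i < n) dual_norm (a i) ^+ 2 + dual_norm (f' (X n)) ^+ 2.
  rewrite big_ord_recr/= {2}/b ltnn; congr (_ + _).
  by apply: eq_bigr => i _; rewrite /b ltn_ord.
rewrite -/beta => regret.
have avg : n.+1%:R * (f (sda_output Q d gamma z r n a) - f x) <=
    \sum_(i < n.+1) (f' (X i) (X i - x) : R).
  by apply: subgradient_average => //; [move=> u /f'P[]|case: QRx].
apply: (le_trans avg); rewrite big_ord_recr/=.
have -> : \sum_(i < n) ((f' (X i) - a i) (X i - x) : R) =
    \sum_(i < n) (f' (X i) (X i - x) : R) - \sum_(i < n) (a i (X i - x) : R).
  rewrite -sumrB; apply: eq_bigr => i _.
  by rewrite add_lfunE opp_lfunE.
have dx : beta * scaled_prox d z r x <= beta * (C * (`|x - z| ^+ 2 / r ^+ 2)).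
  rewrite ler_wpM2l ?(ltW b0)// /scaled_prox (le_trans (dC _ _))//.
    by apply: cball_scaled => //; case: QRx.
  rewrite normrZ ger0_norm ?invr_ge0 ?(ltW r0)// exprMn exprVn.
  by rewrite [X in C * X]mulrC.
have Ln : dual_norm (f' (X n)) ^+ 2 <= L ^+ 2.
  rewrite lerXn2r ?nnegrE ?dual_norm_ge0//; last by case: (f'P _ (QX n)).
  by rewrite (le_trans (dual_norm_ge0 (f' (X n))))//; case: (f'P _ (QX n)).
have c0 : 0 <= r ^+ 2 / (2 * beta * mud).
  by rewrite divr_ge0 ?exprn_ge0 ?mulr_ge0// ltW.
have := ler_wpM2l c0 Ln; lra.
Qed.

End DualAveraging.

(** * Means of possibly nonmeasurable functions, and conditional orthogonality *)

Section Integrals.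
Context {R : realType} {disp : measure_display} {Omega : measurableType disp}.
Variable P : probability Omega R.
Implicit Types (U c h : Omega -> R) (G : set (set Omega)).

Local Notation mean h := (Rintegral P [set: Omega] h).
Local Notation summable h := (P.-integrable [set: Omega] (EFin \o h)).

(** For nonnegative functions the integral is a supremum over simple functions below, which is
    monotone without measurability; the general case splits into positive and negative parts. *)
Lemma le_integral_nonmeasurable (f g : Omega -> \bar R) :
  (forall w, (f w <= g w)%E) -> (\int[P]_w f w <= \int[P]_w g w)%E.
Proof.
have pos (f1 f2 : Omega -> \bar R) : (forall w, (0 <= f1 w)%E) ->
    (forall w, (f1 w <= f2 w)%E) -> (\int[P]_w f1 w <= \int[P]_w f2 w)%E.
  move=> f10 f12; rewrite !ge0_integralTE//; last first.
    by move=> w; exact: le_trans (f12 w).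
  apply: ereal_sup_le => _ [h hf <-]; exists h => // w.
  exact: le_trans (hf w) (f12 w).
move=> fg; rewrite integralE [leRHS]integralE leeB//; apply: pos => w //.
  by apply: (@funepos_le _ _ setT f g) => //; rewrite inE.
by apply: (@funeneg_le _ _ setT f g) => //; rewrite inE.
Qed.

Lemma summable_measurable h : summable h -> measurable_fun setT h.
Proof. by move=> /measurable_int /measurable_EFinP. Qed.

Lemma summable_bounded h (K : R) : measurable_fun setT h ->
  (forall w, `|h w| <= K) -> summable h.
Proof.
move=> mh hK; apply: measurable_bounded_integrable => //.
  by rewrite (le_lt_trans (probability_le1 _ _))// ltry.
exists K; split=> [|r Kr w _]; first exact: num_real.
by rewrite /= (le_trans (hK w))// ltW.
Qed.

Lemma summable_cst (k : R) : summable (cst k).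
Proof. by apply: (@summable_bounded _ `|k|). Qed.

Lemma summableD h c : summable h -> summable c ->
  summable (fun w => h w + c w).
Proof. by move=> hi ci; have := integrableD measurableT hi ci. Qed.

Lemma summableZ (k : R) h : summable h -> summable (fun w => k * h w).
Proof. by move=> hi; have := integrableZl measurableT k hi. Qed.

Lemma summableB h c : summable h -> summable c ->
  summable (fun w => h w - c w).
Proof.
move=> hi ci; have := summableD hi (summableZ (-1) ci).
by under eq_fun do rewrite mulN1r.
Qed.

Lemma summable_mul_bounded U c (K : R) : summable U -> measurable_fun setT c ->
  (forall w, `|c w| <= K) -> summable (fun w => U w * c w).
Proof.
move=> Ui mc cK; have := integrableMl measurableT Ui mc; apply.
exists K; split=> [|r Kr w _]; first exact: num_real.
by rewrite /= (le_trans (cK w))// ltW.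
Qed.

Lemma mean_cst (k : R) : mean (fun=> k) = k.
Proof. by rewrite Rintegral_cst// [X in fine X](probability_setT P) mulr1. Qed.

Lemma summable_sum n (h : 'I_n -> Omega -> R) : (forall i, summable (h i)) ->
  summable (fun w => \sum_(i < n) h i w).
Proof.
move=> hi; elim: n h hi => [|n IH] h hi.
  by under eq_fun do rewrite big_ord0; exact: summable_cst.
under eq_fun do rewrite big_ord_recl.
by apply: summableD => //; exact: IH.
Qed.

Lemma mean_sum n (h : 'I_n -> Omega -> R) : (forall i, summable (h i)) ->
  mean (fun w => \sum_(i < n) h i w) = \sum_(i < n) mean (h i).
Proof.
move=> hi; elim: n h hi => [|n IH] h hi.
  under eq_fun do rewrite big_ord0.
  by rewrite big_ord0; exact: mean_cst.
under eq_fun do rewrite big_ord_recl.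
rewrite RintegralD//; last exact: summable_sum.
by rewrite IH// big_ord_recl.
Qed.

Lemma measurable_fun_ge h :
  (forall a : R, measurable [set w | a <= h w]) -> measurable_fun setT h.
Proof.
move=> hm; apply: (measurability (@RGenCInfty.G R)) => [|/= _ [_] [r] -> <-].
  exact: RGenCInfty.measurableE.
rewrite setTI; have -> : h @^-1` `[r, +oo[ = [set w | r <= h w]; last exact: hm.
by apply/seteqP; split=> w /=; rewrite in_itv/= andbT.
Qed.

(** The sum counts the positive integers up to [x]: it is the integer part of [x]. *)
Lemma floor_count n (x : R) : 0 <= x <= n%:R ->
  `|x - \sum_(k < n) (k.+1%:R <= x)%R%:R| <= 1.
Proof.
elim: n x => [|n IH] x.
  by move=> x0; rewrite big_ord0 subr0 ler_norml; lra.
move=> /andP[x0 xn]; rewrite big_ord_recr/=.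
have [xn'|nx] := leP x n%:R.
  have -> : (n.+1%:R <= x) = false.
    by apply/negbTE; rewrite -ltNge (le_lt_trans xn')// ltr_nat.
  by rewrite addr0 IH// x0.
rewrite (eq_bigr (fun=> 1)); last first.
  move=> i _; have -> // : i.+1%:R <= x.
  by rewrite (le_trans _ (ltW nx))// ler_nat.
rewrite sumr_const card_ord; move: xn; rewrite -natr1 => xn.
by have [h|h] := leP (n%:R + 1) x; rewrite /= ler_norml; lra.
Qed.

(* A [0, 1]-valued function is within 1/n of the average of the indicators of
   its superlevel sets at the multiples of 1/n. *)
Let mean_mul_unit G U c : G `<=` measurable ->
  summable U -> (forall A, G A -> \int[P]_(w in A) U w = 0) ->
  (forall a : R, G [set w | a <= c w]) -> (forall w, 0 <= c w <= 1) ->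
  mean (fun w => U w * c w) = 0.
Proof.
move=> Gm Ui U0 cG c01.
have mc : measurable_fun setT c by apply: measurable_fun_ge => a; exact: Gm.
have Uci : summable (fun w => U w * c w).
  apply: (@summable_mul_bounded _ _ 1) => // w.
  by have := c01 w; rewrite ler_norml; lra.
apply/eqP; rewrite -normr_eq0 eq_le normr_ge0 andbT.
apply/ler_addgt0Pr => eps eps0; rewrite add0r.
have nUi : summable (fun w => `|U w|) by exact: integrable_norm.
set M := mean (fun w => `|U w|).
have M0 : 0 <= M by exact: Rintegral_ge0.
(* The step approximation of [c] costs at most [M / n] in mean, which this [n] keeps below [eps]. *)
pose n := (Num.truncn (M / eps)).+1.
have n0 : (0 : R) < n%:R by rewrite ltr0n.
have Mn : n%:R^-1 * M <= eps.
  rewrite ler_pdivrMl// -ler_pdivrMr// ltW// truncnS_gt//.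
pose A (k : 'I_n) := [set w | k.+1%:R / n%:R <= c w].
have GA k : G (A k) by exact: cG.
pose h (k : 'I_n) w := U w * \1_(A k) w.
have hi k : summable (h k).
  apply: (@summable_mul_bounded _ _ 1) => //.
    by apply: measurable_indic; exact: Gm.
  by move=> w; rewrite indicE ger0_norm ?ler0n// lern1 leq_b1.
have h0 k : mean (h k) = 0.
  rewrite -(U0 _ (GA k)) [RHS]Rintegral_mkcond; apply: eq_Rintegral => w _.
  by rewrite /h patchE indicE; case: ifPn => _; rewrite ?mulr1 ?mulr0.
have cE : mean (fun w => U w * c w) =
    mean (fun w => U w * c w - n%:R^-1 * \sum_(k < n) h k w).
  rewrite RintegralB//; last exact/summableZ/summable_sum.
  rewrite RintegralZl//; last exact: summable_sum.
  by rewrite mean_sum// big1 ?mulr0 ?subr0.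
have di : summable (fun w => U w * c w - n%:R^-1 * \sum_(k < n) h k w).
  by apply: summableB => //; exact/summableZ/summable_sum.
rewrite cE (le_trans (le_normr_Rintegral _ _))// (le_trans _ Mn)//.
rewrite -RintegralZl//; apply: le_Rintegral => //.
- exact: integrable_norm.
- exact: summableZ.
move=> w _; rewrite /h -mulr_sumr mulrCA -mulrBr normrM mulrC ler_wpM2r//.
rewrite -[leRHS]mulr1 -[X in X - _](mulKf (lt0r_neq0 n0)) -mulrBr normrM.
rewrite ger0_norm ?invr_ge0 ?ler0n// ler_wpM2l ?invr_ge0 ?ler0n//.
have := @floor_count n (n%:R * c w) _; rewrite mulr_ge0 ?ler0n//=; last first.
  by case/andP: (c01 w).
rewrite ler_piMr ?ler0n//; last by case/andP: (c01 w).
move=> /(_ isT); congr (`|_ - _| <= _); apply: eq_bigr => k _.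
rewrite indicE; congr (_%:R); congr nat_of_bool.
by apply/idP/idP; rewrite inE /A/= ler_pdivrMr// mulrC.
Qed.

(** The hypothesis on [U] says that its conditional expectation given [G] vanishes. An affine
    rescaling of [c] reduces to values in [0, 1]; the 1 added to the bound keeps the scale
    nonzero. *)
Lemma mean_mul_conditional G U c (K : R) : G `<=` measurable -> G setT ->
  summable U -> (forall A, G A -> \int[P]_(w in A) U w = 0) ->
  (forall a : R, G [set w | a <= c w]) -> (forall w, `|c w| <= K) ->
  summable (fun w => U w * c w) /\ mean (fun w => U w * c w) = 0.
Proof.
move=> Gm GT Ui U0 cG cK.
have mc : measurable_fun setT c by apply: measurable_fun_ge => a; exact: Gm.
split; first exact: summable_mul_bounded mc cK.
pose L : R := `|K| + 1.
have K0 : 0 < L by rewrite /L ltr_wpDl.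
have cL w : `|c w| <= L.
  by rewrite (le_trans (cK w))// /L ler_wpDr// ler_norm.
pose c1 w := (c w + L) / (2 * L).
have L2 : 0 < 2 * L by rewrite mulr_gt0.
have c1G a : G [set w | a <= c1 w].
  have -> : [set w | a <= c1 w] = [set w | a * (2 * L) - L <= c w];
    last exact: cG.
  by apply/seteqP; split=> w /=; rewrite /c1 ler_pdivlMr// lerBlDr.
have c101 w : 0 <= c1 w <= 1.
  have := cL w; rewrite ler_norml => /andP[cL1 cL2].
  by rewrite /c1 ler_pdivlMr// ler_pdivrMr//; lra.
have mc1 : measurable_fun setT c1 by apply: measurable_fun_ge => a; exact: Gm.
have Uc1i : summable (fun w => U w * c1 w).
  apply: (@summable_mul_bounded _ _ 1) => // w.
  by have := c101 w; rewrite ler_norml; lra.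
have -> : (fun w => U w * c w) =
    (fun w => 2 * L * (U w * c1 w) - L * U w).
  apply/funext => w; rewrite /c1; field.
  by rewrite lt0r_neq0.
rewrite RintegralB//; [|exact: summableZ|exact: summableZ].
rewrite !RintegralZl// (mean_mul_unit Gm Ui U0 c1G c101).
by rewrite (U0 _ GT) !mulr0 subrr.
Qed.

(** A bound on the upper integral of [Z]: it is subadditive even where [Z] is not measurable.
    Domination is only almost everywhere because the oracle identifies the conditional mean of an
    answer only almost surely. *)
Definition mean_bound (Z : Omega -> R) (v : R) : Prop :=
  exists H : Omega -> R,
    [/\ summable H, {ae P, forall w, Z w <= H w} & mean H <= v].

Lemma mean_boundW (Z : Omega -> R) (u v : R) :
  u <= v -> mean_bound Z u -> mean_bound Z v.
Proof. by move=> uv [H [Hi ZH Hu]]; exists H; split=> //; exact: le_trans uv. Qed.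

Lemma mean_boundD (Y Z : Omega -> R) (u v : R) :
  mean_bound Y u -> mean_bound Z v -> mean_bound (fun w => Y w + Z w) (u + v).
Proof.
move=> [H [Hi YH Hu]] [K [Ki ZK Kv]]; exists (fun w => H w + K w); split.
- exact: summableD.
- by apply: filterS2 YH ZK => w; exact: lerD.
- by rewrite RintegralD// lerD.
Qed.

Lemma mean_bound_self h (v : R) : summable h -> mean h <= v -> mean_bound h v.
Proof. by move=> hi hv; exists h; split=> //; exact: aeW. Qed.

Lemma mean_bound_cst (k : R) : mean_bound (fun=> k) k.
Proof.
by apply: mean_bound_self; [exact: summable_cst|rewrite mean_cst].
Qed.

Lemma mean_bound_sum n (Z : 'I_n -> Omega -> R) (v : 'I_n -> R) :
  (forall i, mean_bound (Z i) (v i)) ->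
  mean_bound (fun w => \sum_(i < n) Z i w) (\sum_(i < n) v i).
Proof.
elim: n Z v => [|n IH] Z v Zv.
  by under eq_fun do rewrite big_ord0; rewrite big_ord0; exact: mean_bound_cst.
under eq_fun do rewrite big_ord_recl; rewrite big_ord_recl.
by apply: mean_boundD => //; exact: IH.
Qed.

Lemma mean_bound_affine (Z : Omega -> R) (a b v : R) : 0 <= a ->
  mean_bound Z v -> mean_bound (fun w => a * Z w + b) (a * v + b).
Proof.
move=> a0 [H [Hi ZH Hv]]; exists (fun w => a * H w + b).
have aHi := summableZ a Hi; split.
- by apply: summableD => //; exact: summable_cst.
- by apply: filterS ZH => w ZHw; rewrite lerD2r ler_wpM2l.
- rewrite RintegralD//; last exact: summable_cst.
  by rewrite RintegralZl// mean_cst lerD2r ler_wpM2l.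
Qed.

Lemma mean_bound_le (Y Z : Omega -> R) (v : R) :
  (forall w, Y w <= Z w) -> mean_bound Z v -> mean_bound Y v.
Proof.
move=> YZ [H [Hi ZH Hv]]; exists H; split=> //.
by apply: filterS ZH => w; exact: le_trans.
Qed.

(** Monotonicity for a nonmeasurable [Z] requires a majorant valid everywhere, so on the exceptional
    null set the constant [M] replaces [H], at no cost in the integral. *)
Lemma expectation_le_bound (Z : Omega -> R) (M v : R) :
  (forall w, Z w <= M) -> mean_bound Z v -> ('E_P[Z] <= v%:E)%E.
Proof.
move=> ZM [H [Hi [N [mN N0 ZH]] Hv]].
pose h w := H w * \1_(~` N) w + M * \1_N w.
have mH := summable_measurable Hi.
have mh : measurable_fun setT h.
  apply: measurable_funD; apply: measurable_funM => //.
  by apply: measurable_indic; exact: measurableC.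
rewrite unlock; apply: (@le_trans _ _ (\int[P]_w (h w)%:E)%E).
  apply: le_integral_nonmeasurable => w; rewrite lee_fin /h !indicE in_setC.
  have [wN|wN] := boolP (w \in N); first by rewrite mulr0 add0r mulr1.
  rewrite mulr1 mulr0 addr0 leNgt; apply/negP => HZ.
  by move/negP: wN; apply; rewrite inE; apply: ZH => /=; rewrite leNgt HZ.
have -> : (\int[P]_w (h w)%:E = \int[P]_w (H w)%:E)%E.
  apply: ae_eq_integral => //; try exact/measurable_EFinP.
  exists N; split=> // w /=; apply: contra_notP => wN _.
  by rewrite /h !indicE in_setC memNset// mulr1 mulr0 addr0.
rewrite (le_trans _ (_ : (mean H)%:E <= _)%E)//.
by rewrite /Rintegral fineK// integrable_fin_num.
Qed.

End Integrals.

(** * Conditional mean and second moment of an oracle answer *)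

Section OracleMoments.
Context {R : realType} {E : normedVectType R} {disp : measure_display}
  {Omega : measurableType disp}.
Variable P : probability Omega R.
Implicit Types (G : set (set Omega)) (X : Omega -> E)
  (g Y : Omega -> 'Hom(E, R^o)).

Local Notation mean h := (Rintegral P [set: Omega] h).
Local Notation summable h := (P.-integrable [set: Omega] (EFin \o h)).

Lemma borel_setC G (T : Type) (O : set (set T)) (X : Omega -> T) (U : set T) :
  borel_measurable G O X -> O (~` U) -> G (X @^-1` U).
Proof.
move=> XG OU; apply: XG; rewrite -[U]setCK -setTD.
have [_ sC _] := @smallest_sigma_algebra _ setT O.
by apply: sC; exact: sub_sigma_algebra.
Qed.

Lemma borel_continuous_ge G X (h : E -> R) (a : R) :
  borel_measurable G open X -> continuous h -> G [set w | a <= h (X w)].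
Proof.
move=> XG hc; apply: (@borel_setC _ _ open X [set x | a <= h x]) => //.
apply: closed_openC.
apply: (@preimage_closed _ _ h [set t | a <= t]) => [x _|]; first exact: hc.
exact: closed_ge.
Qed.

(** In a basis the pairing is a finite sum of products: a coefficient of [Y - g], with zero
    conditional expectation, times a coordinate of [X], bounded and measurable for [G]. *)
Lemma conditional_noise G g Y X (K : R) :
  G `<=` measurable -> G setT -> is_dual_cond_exp P G g Y ->
  borel_measurable G open X -> (forall w, `|X w| <= K) ->
  summable (fun w => (Y w - g w) (X w)) /\
  mean (fun w => (Y w - g w) (X w)) = 0.
Proof.
move=> Gm GT gY XG XK.
pose e := vbasis {:E}.
have [M M0 cM] := @coord_bounded R E.
pose h (j : 'I_(\dim {:E})) w : R := (Y w - g w) e`_j * coord e j (X w).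
have hP j : summable (h j) /\ mean (h j) = 0.
  have [gi Yi _ Yg] := gY e`_j.
  have -> : h j = fun w => (Y w e`_j - g w e`_j) * coord e j (X w).
    by apply/funext => w; rewrite /h add_lfunE opp_lfunE.
  apply: (@mean_mul_conditional _ _ _ P G _ _ (M * K)) => //.
  - exact: summableB.
  - move=> A GA; have mA := Gm _ GA.
    rewrite RintegralB//; [|exact: (integrableS _ mA _ Yi)
      |exact: (integrableS _ mA _ gi)].
    by rewrite /Rintegral Yg// subrr.
  - by move=> a; apply: borel_continuous_ge => //; exact: coord_continuous.
  - by move=> w; rewrite (le_trans (cM _ _))// ler_wpM2l.
have -> : (fun w => (Y w - g w) (X w)) = fun w => \sum_j h j w.
  apply/funext => w; rewrite lfun_coord; apply: eq_bigr => j _.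
  by rewrite mulrC.
split; first by apply: summable_sum => j; case: (hP j).
rewrite mean_sum; last by move=> j; case: (hP j).
by apply: big1 => j _; case: (hP j).
Qed.

Lemma dual_open_ball (a : R) :
  dual_open [set s : 'Hom(E, R^o) | dual_norm s < a].
Proof.
move=> s sa; exists (a - dual_norm s); first by rewrite subr_gt0.
move=> t ts /=; rewrite -[t](subrK s) (le_lt_trans (dual_normD _ _))//.
by rewrite -ltrBrDr.
Qed.

Lemma dual_norm_measurable G g : G `<=` measurable ->
  borel_measurable G dual_open g ->
  measurable_fun setT (fun w => dual_norm (g w)).
Proof.
move=> Gm gG; apply: measurable_fun_ge => a; apply: Gm.
apply: (@borel_setC _ _ dual_open g [set s | a <= dual_norm s]) => //.
rewrite (_ : ~` _ = [set s | dual_norm s < a]); first exact: dual_open_ball.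
by apply/seteqP; split=> s /=; rewrite ltNge => /negP.
Qed.

(* [v] may fail to be measurable, but max (|g|^2 / 2 - L^2, 0) is measurable
   and lies below |g - v|^2. *)
Lemma answer_second_moment g (v : Omega -> 'Hom(E, R^o)) (L sigma : R) :
  measurable_fun setT (fun w => dual_norm (g w)) ->
  (forall w, dual_norm (v w) <= L) ->
  ('E_P[fun w => (dual_norm (g w - v w) ^+ 2)%R] <= (sigma ^+ 2)%:E)%E ->
  summable (fun w => dual_norm (g w) ^+ 2) /\
  mean (fun w => dual_norm (g w) ^+ 2) <= 2 * (L ^+ 2 + sigma ^+ 2).
Proof.
move=> mg vL; rewrite unlock => noise.
pose h w := Num.max (dual_norm (g w) ^+ 2 / 2 - L ^+ 2) 0.
have h0 w : 0 <= h w by rewrite le_max lexx orbT.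
have mg2 : measurable_fun setT (fun w => dual_norm (g w) ^+ 2).
  exact: measurable_funX.
have mh : measurable_fun setT h.
  apply: measurable_maxr => //.
  by apply: measurable_funB => //; exact: measurable_funM.
have hle : (\int[P]_w (h w)%:E <= (sigma ^+ 2)%:E)%E.
  apply: le_trans noise; apply: le_integral_nonmeasurable => w; rewrite lee_fin.
  rewrite ge_max exprn_even_ge0// andbT.
  have L0 : 0 <= dual_norm (v w) by exact: dual_norm_ge0.
  have := vL w; have := dual_normD (g w - v w) (v w); rewrite subrK.
  have := dual_norm_ge0 (g w); have := dual_norm_ge0 (g w - v w).
  set p := dual_norm (g w - v w); set q := dual_norm (g w).
  set u := dual_norm (v w) in L0 *.
  move=> p0 q0 qpu uL.
  have q2 : q ^+ 2 <= (p + u) ^+ 2 by rewrite lerXn2r// nnegrE addr_ge0.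
  have u2 : u ^+ 2 <= L ^+ 2 by rewrite lerXn2r// nnegrE (le_trans L0).
  have : 0 <= (p - u) ^+ 2 by exact: exprn_even_ge0.
  nra.
have hi : summable h.
  apply/integrableP; split; first exact/measurable_EFinP.
  under eq_integral => w _ do rewrite /= ger0_norm//.
  by rewrite (le_lt_trans hle)// ltry.
have mean_h : mean h <= sigma ^+ 2.
  by rewrite -lee_fin /Rintegral fineK// integrable_fin_num.
have gh w : dual_norm (g w) ^+ 2 <= 2 * h w + 2 * L ^+ 2.
  have : dual_norm (g w) ^+ 2 / 2 - L ^+ 2 <= h w by rewrite le_max lexx.
  lra.
have bi : summable (fun w => 2 * h w + 2 * L ^+ 2).
  by apply: summableD; [exact: summableZ|exact: summable_cst].
have gi : summable (fun w => dual_norm (g w) ^+ 2).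
  apply: le_integrable bi => //; first exact/measurable_EFinP.
  move=> w _ /=; rewrite lee_fin ger0_norm ?exprn_even_ge0//.
  by rewrite (le_trans (gh w))// ler_norm.
split=> //; have := @le_Rintegral _ _ _ P setT _ _ measurableT gi bi.
move=> /(_ (fun w _ => gh w)) /le_trans; apply.
rewrite RintegralD//; [|exact: summableZ|exact: summable_cst].
by rewrite mean_cst RintegralZl//; lra.
Qed.

End OracleMoments.

(** * Real inequalities behind the rates and the number of stages *)

Section Constants.
Context {R : realType}.
Implicit Types (rho u b x y kappa : R).

Lemma powR_le_root x y rho : 1 < rho -> 0 <= x -> 0 <= y ->
  x `^ (rho - 1) <= y -> x <= y `^ (rho - 1)^-1.
Proof.
move=> rho1 x0 y0 xy; have r1 : 0 < rho - 1 by rewrite subr_gt0.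
have -> : x = (x `^ (rho - 1)) `^ (rho - 1)^-1.
  by rewrite -powRrM mulfV ?gt_eqF// powRr1.
by apply: ge0_ler_powR => //; rewrite ?invr_ge0 ?(ltW r1)// nnegrE// powR_ge0.
Qed.

Lemma root_le_powR x y rho : 1 < rho -> 0 <= x -> 0 <= y ->
  y `^ (rho - 1)^-1 <= x -> y <= x `^ (rho - 1).
Proof.
move=> rho1 x0 y0 yx; have r1 : 0 < rho - 1 by rewrite subr_gt0.
have -> : y = (y `^ (rho - 1)^-1) `^ (rho - 1).
  by rewrite -powRrM mulVf ?gt_eqF// powRr1.
by apply: ge0_ler_powR => //; rewrite ?(ltW r1)// nnegrE// powR_ge0.
Qed.

Lemma powR_split x rho : 0 <= x -> 1 < rho -> x `^ rho = x * x `^ (rho - 1).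
Proof.
move=> x0 rho1; rewrite -{2}[x]powRr1// -powRD; first by congr (_ `^ _); ring.
by apply/implyP => /eqP; lra.
Qed.

(* The tangent at [b] of the concave function [u^rho |-> u^2]. *)
Lemma square_le_powR u b rho : 0 <= u -> 0 < b -> 2 <= rho ->
  u ^+ 2 <= b ^+ 2 * (2 / rho * (u `^ rho / b `^ rho) + (1 - 2 / rho)).
Proof.
move=> u0 b0 rho2.
have rho0 : 0 < rho by lra.
pose t := u / b.
have t0 : 0 <= t by rewrite divr_ge0// ltW.
have ut : u = t * b by rewrite /t divfK// gt_eqF.
have -> : u `^ rho / b `^ rho = t `^ rho.
  by rewrite ut powRM// ?(ltW b0)// mulfK// gt_eqF// powR_gt0.
rewrite ut exprMn mulrC ler_pM2l ?exprn_gt0//.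
have t2 : t ^+ 2 = t `^ 2 by rewrite -powR_mulrn.
(* Young's inequality for [t ^+ 2] and 1 with exponent [rho / 2]; its conjugate exponent is infinite
   at [rho = 2], hence the separate case. *)
have [->|rhon2] := eqVneq rho 2; first by rewrite divff// subrr addr0 mul1r t2.
have rho2' : 2 < rho by rewrite lt_neqAle eq_sym rhon2.
have p1 : 2 / rho < 1 by rewrite ltr_pdivrMr// mul1r.
have pq : (rho / 2)^-1 + (1 - 2 / rho)^-1^-1 = 1.
  by rewrite invf_div invrK addrC subrK.
have := conjugate_powR (exprn_ge0 2 t0) ler01 _ _ pq.
rewrite divr_gt0// invr_gt0 subr_gt0 p1 mulr1 powR1 mul1r invrK.
move=> /(_ isT isT); rewrite {2}t2 -powRrM.
by rewrite mulrCA divff// mulr1 invf_div [t `^ _ * _]mulrC.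
Qed.

(** With [th = sqrt (S2 / (2 * C * mu))] and [s = sqrt (n + 1)], the weight turns the distance term
    into [th * C * s * D / r] and the answer term into [2 * th * C * s * r]. The lower bound on [n]
    is what makes [th * C / s] at most [kappa / 2]. *)
Lemma stage_rate (C mu S2 R0 r D lN N : R) n :
  let beta := R0 ^+ 2 / r * Num.sqrt (S2 / (2 * C * mu))
    * Num.sqrt n.+1%:R in
  0 < C -> 0 < mu -> 0 < S2 -> 0 < R0 -> 0 < r -> 0 <= D -> 0 < lN -> 0 < N ->
  2 * N / lN <= n.+1%:R ->
  beta * (C * (D / R0 ^+ 2)) + R0 ^+ 2 / (2 * beta * mu) * (n.+1%:R * (2 * S2))
  <= n.+1%:R * (Num.sqrt (C * S2 * lN / (mu * N)) / 2 * (D / r + 2 * r)).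
Proof.
move=> beta C0 mu0 S0 R00 r0 D0 l0 N0 Nn.
set th := Num.sqrt (S2 / _) in beta *; set s := Num.sqrt n.+1%:R in beta *.
set k := Num.sqrt _.
have th2 : th ^+ 2 = S2 / (2 * C * mu).
  by rewrite sqr_sqrtr// divr_ge0 ?mulr_ge0// ltW.
have th0 : 0 < th by rewrite sqrtr_gt0 divr_gt0 ?mulr_gt0.
have s2 : s ^+ 2 = n.+1%:R by rewrite sqr_sqrtr.
have s0 : 0 < s by rewrite sqrtr_gt0.
have S2E : S2 = 2 * C * mu * th ^+ 2.
  by rewrite th2 mulrCA divff ?mulr1// gt_eqF// !mulr_gt0.
have -> : beta * (C * (D / R0 ^+ 2))
    + R0 ^+ 2 / (2 * beta * mu) * (n.+1%:R * (2 * S2))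
    = s ^+ 2 * (th * C / s * (D / r + 2 * r)).
  rewrite -s2 S2E /beta; field; rewrite !gt_eqF//.
rewrite s2 ler_pM2l// ler_wpM2r//.
  by rewrite addr_ge0 ?divr_ge0 ?mulr_ge0// ltW.
rewrite -(@ler_pXn2r _ 2)// ?nnegrE; last 2 first.
- by rewrite divr_ge0 ?mulr_ge0// ltW.
- by rewrite divr_ge0// sqrtr_ge0.
rewrite 2!exprMn exprVn s2 exprMn th2 exprVn sqr_sqrtr; last first.
  by rewrite divr_ge0 ?mulr_ge0// ltW.
have -> : S2 / (2 * C * mu) * C ^+ 2 / n.+1%:R =
    (C * S2 / (2 * mu)) * n.+1%:R^-1.
  by field; rewrite !gt_eqF// ltr0n.
have -> : C * S2 * lN / (mu * N) / 2 ^+ 2 =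
    (C * S2 / (2 * mu)) * (2 * N / lN)^-1.
  by field; rewrite !gt_eqF.
apply: ler_wpM2l; first by rewrite divr_ge0 ?mulr_ge0// ltW.
by rewrite lef_pV2 ?posrE ?ltr0n// divr_gt0 ?mulr_gt0.
Qed.

Lemma powR_inv_le1 x p : 1 <= x -> 0 <= p <= 1 -> x `^ p <= x.
Proof.
move=> x1 /andP[p0 p1]; rewrite -[leRHS]powRr1; last by lra.
by rewrite ler_powR.
Qed.

(** The base is the square of [4 * kappa / muf ^ (1 / rho)], and
    [rho / (rho - 1) = 1 + 1 / (rho - 1)] splits off one factor [4 * kappa]. *)
Lemma target_rate (C mu muf S2 lN N rho : R) :
  let kappa := Num.sqrt (C * S2 * lN / (mu * N)) in
  0 < C -> 0 < mu -> 0 < muf -> 0 < S2 -> 0 < lN -> 0 < N -> 2 <= rho ->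
  4 * (16 * S2 * C * lN / (muf `^ (2 / rho) * mu * N))
    `^ (rho / (2 * (rho - 1))) =
  16 * kappa * (4 * kappa / muf) `^ (rho - 1)^-1.
Proof.
move=> kappa C0 mu0 muf0 S0 l0 N0 rho2.
have k0 : 0 < kappa by rewrite sqrtr_gt0 divr_gt0 ?mulr_gt0.
have k2 : kappa ^+ 2 = C * S2 * lN / (mu * N).
  by rewrite sqr_sqrtr// divr_ge0 ?mulr_ge0// ltW.
have mp : 0 < muf `^ rho^-1 by exact: powR_gt0.
have -> : 16 * S2 * C * lN / (muf `^ (2 / rho) * mu * N) =
    (4 * kappa / muf `^ rho^-1) `^ 2.
  rewrite powR_mulrn; last by rewrite divr_ge0 ?mulr_ge0// ltW.
  rewrite exprMn exprMn k2 exprVn [2 / rho]mulrC powRrM powR_mulrn ?powR_ge0//.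
  by field; rewrite !gt_eqF.
rewrite -powRrM.
have -> : 2 * (rho / (2 * (rho - 1))) = rho * (rho - 1)^-1.
  by field; rewrite gt_eqF//; lra.
rewrite powRrM powRM ?mulr_ge0 ?invr_ge0 ?(ltW mp) ?(ltW k0)//.
have -> : (muf `^ rho^-1)^-1 `^ rho = muf^-1.
  rewrite -[_^-1 in LHS]powR_inv1 ?(ltW mp)// -!powRrM.
  rewrite (_ : _ * _ = -1); last by field; rewrite gt_eqF//; lra.
  by rewrite powR_inv1// ltW.
rewrite (@powR_split (4 * kappa)); [|by rewrite mulr_ge0// ltW|lra].
have -> : 4 * kappa * (4 * kappa) `^ (rho - 1) / muf =
    (4 * kappa) `^ (rho - 1) * (4 * kappa / muf) by ring.
rewrite powRM ?powR_ge0 ?divr_ge0 ?mulr_ge0 ?ltW//.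
rewrite -powRrM mulfV ?powRr1 ?mulr_ge0 ?ltW//; last by rewrite gt_eqF//; lra.
ring.
Qed.

(** The exponent is at most 1, so replacing 6 by 4 under the power costs at most [3 / 2]: the factor
    10 becomes 15, below 16. *)
Lemma late_stage_rate kappa muf rho : 0 < kappa -> 0 < muf -> 2 <= rho ->
  5 * kappa * (2 * (6 * kappa / muf) `^ (rho - 1)^-1) <=
  16 * kappa * (4 * kappa / muf) `^ (rho - 1)^-1.
Proof.
move=> k0 muf0 rho2.
have -> : 6 * kappa / muf = 3 / 2 * (4 * kappa / muf) by field; rewrite gt_eqF.
have q0 : 0 <= 4 * kappa / muf by rewrite divr_ge0 ?mulr_ge0// ltW.
rewrite [X in 2 * X]powRM//.
have h : (3 / 2 : R) `^ (rho - 1)^-1 <= 3 / 2.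
  apply: powR_inv_le1; first lra.
  by rewrite invr_ge0 subr_ge0 invf_le1; [apply/andP; split|]; lra.
have := powR_ge0 (4 * kappa / muf) (rho - 1)^-1.
set q := (4 * kappa / muf) `^ _; set t := (3 / 2) `^ _ in h *.
move=> qq; have tq : t * q <= 3 / 2 * q by rewrite ler_wpM2r.
have -> : 5 * kappa * (2 * (t * q)) = kappa * (10 * (t * q)) by ring.
have -> : 16 * kappa * q = kappa * (16 * q) by ring.
by rewrite ler_pM2l//; lra.
Qed.

(** For the case where the bound [3 * kappa * r] survives to the last stage; [p] stands for
    [2 ^ - m]. Base and exponent being at most 1, [p <= (4 * kappa / S) ^ (1 / (rho - 1))]. Then [S]
    cancels against the bound on [r], and the factor is 12 instead of 16. *)
Lemma last_stage_rate kappa muf rho (L S r p : R) :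
  0 < kappa -> 0 < muf -> 2 <= rho -> 0 < L -> L <= S -> 0 <= p ->
  p <= 4 * kappa / S -> 4 * kappa / S <= 1 ->
  r <= 2 * (2 * L / muf) `^ (rho - 1)^-1 ->
  3 * kappa * (r * p) <= 16 * kappa * (4 * kappa / muf) `^ (rho - 1)^-1.
Proof.
move=> k0 muf0 rho2 L0 LS p0 pk k1 rL.
have S0 : 0 < S by exact: lt_le_trans LS.
set t := (rho - 1)^-1.
have t01 : 0 <= t <= 1.
  by rewrite /t invr_ge0 subr_ge0 invf_le1; [apply/andP; split|]; lra.
have t0 : 0 <= t by case/andP: t01.
have pt : p <= (4 * kappa / S) `^ t.
  apply: (le_trans pk); have ks : 0 < 4 * kappa / S by rewrite divr_gt0 ?mulr_gt0.
  rewrite -{1}[4 * kappa / S]powRr1 ?(ltW ks)//.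
  by rewrite ger_powR ?ks//; case/andP: t01.
have rS : r <= 2 * (2 * S / muf) `^ t.
  apply: (le_trans rL); rewrite ler_pM2l// ge0_ler_powR//.
  - by rewrite nnegrE divr_ge0 ?mulr_ge0// ltW.
  - by rewrite nnegrE divr_ge0 ?mulr_ge0// ltW.
  - by rewrite ler_pM2r ?invr_gt0// ler_pM2l.
have rp : r * p <= 2 * (2 * S / muf) `^ t * (4 * kappa / S) `^ t.
  apply: (@le_trans _ _ (2 * (2 * S / muf) `^ t * p)); first exact: ler_wpM2r.
  by rewrite ler_wpM2l// mulr_ge0// powR_ge0.
move: rp; rewrite -mulrA -powRM; [|by rewrite divr_ge0 ?mulr_ge0// ltW..].
have -> : 2 * S / muf * (4 * kappa / S) = 2 * (4 * kappa / muf).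
  by field; rewrite !gt_eqF.
rewrite powRM; [|by []|by rewrite divr_ge0 ?mulr_ge0// ltW].
have h2 : (2 : R) `^ t <= 2 by apply: powR_inv_le1 => //; rewrite ler1n.
have := powR_ge0 (4 * kappa / muf) t; set q := (4 * kappa / muf) `^ t.
move=> q0 rp; have tq : 2 `^ t * q <= 2 * q by rewrite ler_wpM2r.
have -> : 3 * kappa * (r * p) = kappa * (3 * (r * p)) by ring.
have -> : 16 * kappa * q = kappa * (16 * q) by ring.
by rewrite ler_pM2l//; lra.
Qed.

Lemma ln2_gt0 : 0 < ln (2 : R).
Proof. by rewrite ln_gt0// ltr1n. Qed.

(** The floor is [m + 1], so [4 ^ (m + 1) <= A < 4 ^ (m + 2)], and [m >= 1] gives 16. Since
    [mu <= 4 * C] and [lN >= 2], [A] is at most [2 * N], whence [m <= lN / 2]. The successor of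
    [N %/ m] absorbs the rounding of the division. *)
Lemma stage_count (N m : nat) (mu C : R) :
  let lN := log2 N%:R in
  let A := mu * N%:R / (C * lN) in
  (4 < N)%N -> (1 <= m)%N -> 0 < mu -> mu <= 4 * C ->
  m%:Z = Num.floor (2^-1 * log2 A) - 1 ->
  [/\ 2 <= lN, (0 < N %/ m)%N, 2 * N%:R / lN <= (N %/ m).+1%:R,
    A < 16 * (2 ^+ m) ^+ 2 & 16 <= A].
Proof.
move=> lN A N4 m1 mu0 muC mA.
have l20 := ln2_gt0.
have N0 : (0 : R) < N%:R by rewrite ltr0n (ltn_trans _ N4).
have C0 : 0 < C by lra.
have lnX (x : R) k : 0 < x -> ln (x ^+ k) = k%:R * ln x.
  by move=> x0; rewrite lnXn// mulr_natl.
have l2 : 2 <= lN.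
  rewrite /lN /log2 ler_pdivlMr// -lnX// ler_ln ?posrE// ?exprn_gt0//.
  by rewrite -natrX ler_nat ltnW.
have l0 : 0 < lN by lra.
have lN_le : lN <= N%:R.
  rewrite /lN /log2 ler_pdivrMr// -lnX// ler_ln ?posrE ?exprn_gt0//.
  by rewrite -natrX ler_nat ltnW// ltn_expl.
have A0 : 0 < A by rewrite /A divr_gt0// mulr_gt0.
have fl : m.+1%:Z = Num.floor (2^-1 * log2 A).
  by rewrite -addn1 PoszD mA subrK.
have mle : m.+1%:R <= 2^-1 * log2 A.
  by have := floor_le (2^-1 * log2 A); rewrite -fl.
have mgt : 2^-1 * log2 A < m.+2%:R.
  have := floorD1_gt (2^-1 * log2 A); rewrite -fl.
  by rewrite -[m.+1%:Z + 1]/(m.+1%:Z + 1%:Z) -PoszD addn1.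
have lnA : ln A = log2 A * ln 2 by rewrite /log2 divfK// gt_eqF.
have A16 : 16 <= A.
  have -> : (16 : R) = 2 ^+ 4 by rewrite -natrX.
  rewrite -ler_ln ?posrE ?exprn_gt0// lnX// lnA ler_pM2r//.
  have : (2 : R) <= m.+1%:R by rewrite ler_nat.
  lra.
have Am : A < 16 * (2 ^+ m) ^+ 2.
  have -> : (16 : R) = 2 ^+ 4 by rewrite -natrX.
  rewrite -exprM -exprD -ltr_ln ?posrE ?exprn_gt0// lnX// lnA ltr_pM2r//.
  move: mgt; rewrite natrD natrM -[m.+2]addn2 [X in _ < X -> _]natrD; lra.
have A2N : A <= 2 * N%:R.
  rewrite /A ler_pdivrMr; last by rewrite mulr_gt0.
  have : mu * N%:R <= 4 * C * N%:R by rewrite ler_pM2r.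
  have : 2 * (C * N%:R) <= lN * (C * N%:R) by rewrite ler_pM2r// mulr_gt0.
  lra.
have mlN : m%:R <= lN / 2.
  have : log2 A <= 1 + lN.
    rewrite /log2 ler_pdivrMr// mulrDl mul1r /lN /log2 divfK ?gt_eqF//.
    have N20 : 0 < 2 * N%:R :> R by rewrite mulr_gt0.
    have : ln A <= ln (2 * N%:R) by rewrite ler_ln ?posrE.
    by rewrite lnM ?posrE.
  by move: mle; rewrite -addn1 natrD; lra.
have m0 : (0 : R) < m%:R by rewrite ltr0n.
have N2 : 2 * N%:R / lN <= (N %/ m).+1%:R.
  apply: (@le_trans _ _ (N%:R / m%:R)).
    rewrite ler_pdivrMr// mulrAC ler_pdivlMr//.
    have : N%:R * m%:R <= N%:R * (lN / 2) by rewrite ler_pM2l.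
    lra.
  by rewrite ler_pdivrMr// -natrM ler_nat ltnW// ltn_ceil.
split=> //; rewrite divn_gt0// -(ler_nat R) (le_trans mlN)//.
by rewrite (le_trans _ lN_le)//; lra.
Qed.

End Constants.

(** * Consequences of uniform convexity at midpoints *)

Section UniformConvexity.
Context {R : realType} {E : normedVectType R}.
Variables (Q : set E) (f : E -> R) (rho muf : R).
Hypothesis Q_convex : convex_set (Q : set (convex_lmodType E)).
Hypotheses (rho_ge2 : 2 <= rho) (muf_gt0 : 0 < muf).
Hypothesis f_uc : uniformly_convex Q f rho muf.
Implicit Types x y : E.

Let half : 1 - 2^-1 = 2^-1 :> R. Proof. by field. Qed.

Let rho_gt1 : 1 < rho.
Proof. by apply: lt_le_trans rho_ge2; rewrite ltr1n. Qed.

Let half01 : 0 <= (2^-1 : R) <= 1.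
Proof. by rewrite invr_ge0 ler0n invf_le1// ler1n. Qed.

Lemma midpoint_in x y : Q x -> Q y -> Q (2^-1 *: (x + y)).
Proof.
by move=> Qx Qy; have := convex_comb Q_convex Qx Qy half01; rewrite half scalerDr.
Qed.

Lemma uniformly_convex_midpoint x y : Q x -> Q y ->
  f (2^-1 *: (x + y)) <=
  2^-1 * f x + 2^-1 * f y - 2^-1 * muf * (`|x - y| / 2) `^ rho.
Proof.
move=> Qx Qy; have := f_uc Qx Qy half01; rewrite half -scalerDr.
have h : (2^-1 : R) `^ rho = 2^-1 * 2^-1 `^ (rho - 1).
  by rewrite powR_split ?invr_ge0.
rewrite powRM ?invr_ge0// h; lra.
Qed.

(** The midpoint value cannot fall below the minimum, so the modulus term has to be paid by the gap
    at [x]. *)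
Lemma uniformly_convex_growth x xs : Q x -> Q xs ->
  (forall u, Q u -> f xs <= f u) ->
  muf * (`|x - xs| / 2) `^ rho <= f x - f xs.
Proof.
move=> Qx Qxs fmin; have := uniformly_convex_midpoint Qx Qxs.
have := fmin _ (midpoint_in Qx Qxs); lra.
Qed.

(** With [u] half the distance, uniform convexity lowers the midpoint value below the average by
    [muf * u ^ rho / 2], while subgradients bounded by [L] allow a drop of at most [L * u]. *)
Lemma uniformly_convex_distance (f' : E -> 'Hom(E, R^o)) (L : R) x y :
  (forall u, Q u -> subdifferential Q f u (f' u) /\ dual_norm (f' u) <= L) ->
  0 < L -> Q x -> Q y -> `|x - y| <= 2 * (2 * L / muf) `^ (rho - 1)^-1.
Proof.
move=> f'P L0 Qx Qy.
have Qz := midpoint_in Qx Qy; set z := _ *: _ in Qz.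
have lower u : Q u -> `|u - z| = `|x - y| / 2 ->
    f u - L * (`|x - y| / 2) <= f z.
  move=> Qu uz; have [sub dn] := f'P _ Qu.
  have := sub _ Qz; have := dual_normP_abs (f' u) (z - u).
  rewrite distrC uz ler_norml => /andP[h _].
  have : dual_norm (f' u) * (`|x - y| / 2) <= L * (`|x - y| / 2).
    by rewrite ler_wpM2r// divr_ge0.
  lra.
have halfn (u : E) : `|2^-1 *: u| = `|u| / 2.
  by rewrite normrZ ger0_norm ?invr_ge0// mulrC.
have xz : `|x - z| = `|x - y| / 2.
  rewrite -halfn; congr (`|_|); rewrite /z scalerDr scalerBr opprD addrA.
  by congr (_ - _); rewrite -{1}[x]scale1r -scalerBl half.
have yz : `|y - z| = `|x - y| / 2.
  rewrite distrC -halfn; congr (`|_|); rewrite /z scalerDr scalerBr -addrA.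
  by congr (_ + _); rewrite -{2}[y]scale1r -scalerBl -scaleNr -opprB half.
have := uniformly_convex_midpoint Qx Qy; rewrite -/z.
have := lower _ Qx xz; have := lower _ Qy yz.
have : 0 <= `|x - y| / 2 by rewrite divr_ge0.
set u := `|x - y| / 2 => u0 h1 h2 h3.
have {h1 h2 h3} uL : muf * u `^ rho <= 2 * L * u by lra.
have : u <= (2 * L / muf) `^ (rho - 1)^-1.
  have [->|un0] := eqVneq u 0; first exact: powR_ge0.
  have u1 : 0 < u by rewrite lt_neqAle eq_sym un0.
  apply: powR_le_root => //; first by rewrite divr_ge0 ?mulr_ge0// ltW.
  rewrite ler_pdivlMr// -(ler_pM2l u1) mulrA -powR_split//; lra.
rewrite /u; lra.
Qed.

End UniformConvexity.

(** * Diameter of the feasible set and modulus of the prox-function *)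

Lemma diameter_ge (R : realType) (E : normedVectType R) (Q : set E) x y :
  bounded_set Q -> Q x -> Q y -> `|x - y| <= diameter Q.
Proof.
move=> Qb Qx Qy; apply: sup_upper_bound; last by exists x => //; exists y.
split; first by exists `|x - y|, x => //; exists y.
have [K K0 QK] := ex_strict_bound_gt0 Qb.
exists (K + K) => _ [a Qa] [b Qb' <-].
by rewrite (le_trans (ler_normB _ _))// lerD// ltW// QK.
Qed.

Lemma diameter_le (R : realType) (E : normedVectType R) (Q : set E) (M : R) :
  Q !=set0 -> (forall x y, Q x -> Q y -> `|x - y| <= M) -> diameter Q <= M.
Proof.
move=> [z Qz] QM; apply: ge_sup; first by exists `|z - z|, z => //; exists z.
by move=> _ [x Qx] [y Qy <-]; exact: QM.
Qed.

(** Strong convexity at the midpoint of 0 and a unit vector, where [d] is nonnegative. The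
    inequality makes [Cd] positive and bounds the number of stages. *)
Lemma prox_modulus_le (R : realType) (E : normedVectType R) (d : E -> R)
    (mud C : R) (x : E) : x != 0 -> prox_function d mud ->
  (forall u, cball 0 1 u -> d u <= C * `|u| ^+ 2) -> mud <= 4 * C.
Proof.
move=> x0 [_ d0 dge0 dsc] dC.
pose u := `|x|^-1 *: x.
have nu : `|u| = 1.
  by rewrite normrZ ger0_norm ?invr_ge0// mulVf// normr_eq0.
have Bu : cball 0 1 u by rewrite cball01 nu.
have B0 : cball (0 : E) 1 0 by rewrite cball01 normr0.
have h01 : 0 <= (2^-1 : R) <= 1 by rewrite invr_ge0 ler0n invf_le1// ler1n.
have := dsc _ _ _ Bu B0 h01; rewrite scaler0 addr0 d0 subr0 nu.
have : 0 <= d (2^-1 *: u).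
  apply: dge0; rewrite cball01 normrZ nu mulr1 ger0_norm ?invr_ge0//.
  by case/andP: h01.
have := dC _ Bu; rewrite nu; lra.
Qed.

(** * Mean bounds along the stages *)

Section MultistageConvergence.
Context {R : realType} {E : normedVectType R}.
Variables (Q : set E) (f : E -> R) (f' : E -> 'Hom(E, R^o)).
Variables (rho muf L R0 : R) (d : E -> R) (mud Cd : R).
Context {disp : measure_display} {Omega : measurableType disp}.
Variables (P : probability Omega R) (F : nat -> set (set Omega)).
Variables (g : nat -> Omega -> 'Hom(E, R^o)) (sigma : R).
Variables (m n : nat) (x0 xs : E) (N lN : R).

Local Notation S2 := (L ^+ 2 + sigma ^+ 2).
Local Notation kappa := (Num.sqrt (Cd * S2 * lN / (mud * N))).
Local Notation y k w :=
  (stage_center Q d mud Cd L sigma R0 x0 n (fun j => g j w) k).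
Local Notation X t w :=
  (query_point Q d mud Cd L sigma R0 x0 n (fun j => g j w) t).
Local Notation radius k := (R0 / 2 ^+ k).

Hypotheses (Q_closed : closed Q) (Q_bounded : bounded_set Q).
Hypothesis Q_convex : convex_set (Q : set (convex_lmodType E)).
Hypothesis Q_diameter : forall x z, Q x -> Q z -> `|x - z| <= R0.
Hypotheses (R0_gt0 : 0 < R0) (rho_ge2 : 2 <= rho) (muf_gt0 : 0 < muf).
Hypothesis f_uc : uniformly_convex Q f rho muf.
Hypothesis L_gt0 : 0 < L.
Hypothesis f'P :
  forall x, Q x -> subdifferential Q f x (f' x) /\ dual_norm (f' x) <= L.
Hypotheses (Q_xs : Q xs) (f_min : forall x, Q x -> f xs <= f x).
Hypotheses (mud_gt0 : 0 < mud) (d_prox : prox_function d mud).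
Hypothesis Cd_gt0 : 0 < Cd.
Hypothesis d_growth : forall x, cball 0 1 x -> d x <= Cd * `|x| ^+ 2.
Hypothesis F_filtration : filtration F.
Hypotheses (Q_x0 : Q x0) (n_gt0 : (0 < n)%N).
Hypotheses (N_gt0 : 0 < N) (lN_gt0 : 0 < lN).
Hypothesis n_large : 2 * N / lN <= n.+1%:R.
Hypothesis oracle :
  unbiased_oracle P Q f f' F (fun t w => X t w) g (m * n).
Hypothesis noise : forall t, (t < m * n)%N ->
  ('E_P[fun w => (dual_norm (g t w - f' (X t w)) ^+ 2)%R]
    <= (sigma ^+ 2)%:E)%E.

Let S2_gt0 : 0 < S2.
Proof. by rewrite ltr_pwDl ?exprn_gt0// sqr_ge0. Qed.

Let radius_gt0 k : 0 < radius k.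
Proof. by rewrite divr_gt0// exprn_gt0. Qed.

Let kappa_gt0 : 0 < kappa.
Proof. by rewrite sqrtr_gt0 divr_gt0// !mulr_gt0. Qed.

Let stage_gamma_gt0 k : 0 < stage_gamma mud Cd L sigma R0 k.
Proof.
rewrite /stage_gamma mulr_gt0//; first by rewrite divr_gt0 ?exprn_gt0.
by rewrite sqrtr_gt0 divr_gt0// !mulr_gt0.
Qed.

Let F_measurable t : F t `<=` measurable.
Proof. by case: F_filtration. Qed.

Let F_setT t : F t setT.
Proof.
case: F_filtration => /(_ t)[F0 FC _] _ _.
by rewrite -(setD0 setT); exact: FC.
Qed.

Let borelW s t (Z : Omega -> E) : (s <= t)%N ->
  borel_measurable (F s) open Z -> borel_measurable (F t) open Z.
Proof. by case: F_filtration => _ _ Fm st ZF U /ZF; exact: Fm. Qed.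

Let borel_cst t (x : E) : borel_measurable (F t) open (fun=> x).
Proof.
case: F_filtration => /(_ t)[F0 _ _] _ _ U _; rewrite preimage_cst.
by case: ifPn => _; [exact: F_setT|exact: F0].
Qed.

Lemma stage_center_in k w : Q (y k w).
Proof.
elim: k => [|k IH] /=; first exact: Q_x0.
by apply: (@sda_output_in _ _ Q d mud).
Qed.

Lemma query_point_stage k i w : (i < n)%N ->
  X (k * n + i)%N w = sda_point Q d (stage_gamma mud Cd L sigma R0 k) (y k w)
    R0 n (fun i => g (k * n + i)%N w) i.
Proof.
move=> ni; rewrite /query_point divnMDl// divn_small// addn0 modnMDl.
by rewrite modn_small.
Qed.

Let stage_index k i : (k < m)%N -> (i < n)%N -> (k * n + i < m * n)%N.
Proof.
move=> km ni; apply: (@leq_trans (k.+1 * n)); last by rewrite leq_mul2r km orbT.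
by rewrite mulSn addnC ltn_add2r.
Qed.

(** A stage's center is its own first query point, so the oracle assumption supplies the
    measurability. This reaches only [k < m], since no query is made at the final output. *)
Lemma center_measurable k : (k < m)%N ->
  borel_measurable (F (k * n)) open (fun w => y k w).
Proof.
move=> km; have [_ XF _ _] := oracle (stage_index km n_gt0).
move: XF; rewrite addn0; congr (borel_measurable _ _ _).
by apply/funext => w; rewrite -[(k * n)%N]addn0 query_point_stage.
Qed.

(** The version [Y] of the conditional expectation replaces [f'] along the queries, which it equals
    almost surely. The query and [Z] are both bounded and known before answer [t], so each pairing
    has mean zero. *)
Lemma noise_mean_bound t (Z : Omega -> E) : (t < m * n)%N ->
  (forall w, Q (Z w)) -> borel_measurable (F t) open Z ->
  mean_bound P (fun w => (f' (X t w) - g t w) (X t w - Z w)) 0.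
Proof.
move=> tT QZ ZF; have [QX XF _ [Y gY YE]] := oracle tT.
have [K K0 QK] := ex_strict_bound_gt0 Q_bounded.
have [Xi X0] := @conditional_noise _ _ _ _ P (F t) (g t) Y (fun w => X t w) K
  (@F_measurable t) (@F_setT t) gY XF (fun w => ltW (QK _ (QX w))).
have [Zi Z0] := @conditional_noise _ _ _ _ P (F t) (g t) Y Z K
  (@F_measurable t) (@F_setT t) gY ZF (fun w => ltW (QK _ (QZ w))).
exists (fun w => (Y w - g t w) (X t w) - (Y w - g t w) (Z w)); split.
- exact: summableB.
- by apply: filterS YE => w [-> _]; rewrite linearB.
- by rewrite RintegralB// X0 Z0 subrr.
Qed.

Lemma stage_mean_bound k (Z : Omega -> E) (D : R) : (k < m)%N ->
  (forall w, Q (Z w)) -> borel_measurable (F (k * n)) open Z -> 0 <= D ->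
  mean_bound P (fun w => `|Z w - y k w| ^+ 2) D ->
  mean_bound P (fun w => f (y k.+1 w) - f (Z w))
    (kappa / 2 * (D / radius k + 2 * radius k)).
Proof.
move=> km QZ ZF D0 ZD.
set r := radius k.
pose beta := stage_gamma mud Cd L sigma R0 k * Num.sqrt n.+1%:R.
have beta0 : 0 < beta by rewrite mulr_gt0// sqrtr_gt0.
pose c := R0 ^+ 2 / (2 * beta * mud).
have bm0 : 0 < 2 * beta * mud by apply: mulr_gt0 => //; exact: mulr_gt0.
have c0 : 0 <= c by rewrite divr_ge0 ?exprn_ge0 ?(ltW bm0) ?(ltW R0_gt0).
have distance_bound : mean_bound P
    (fun w => beta * (Cd * (`|Z w - y k w| ^+ 2 / R0 ^+ 2)))
    (beta * (Cd * (D / R0 ^+ 2))).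
  have a0 : 0 <= beta * Cd / R0 ^+ 2.
    by rewrite divr_ge0 ?exprn_ge0 ?(ltW R0_gt0) ?(ltW (mulr_gt0 beta0 Cd_gt0)).
  have -> : beta * (Cd * (D / R0 ^+ 2)) = beta * Cd / R0 ^+ 2 * D + 0 by ring.
  apply: mean_bound_le (mean_bound_affine 0 a0 ZD) => w.
  by rewrite le_eqVlt; apply/orP; left; apply/eqP; ring.
have answers_bound : mean_bound P
    (fun w => \sum_(i < n) dual_norm (g (k * n + i)%N w) ^+ 2)
    (\sum_(i < n) 2 * S2).
  apply: mean_bound_sum => i.
  have iT := stage_index km (ltn_ord i).
  have [QX _ gF _] := oracle iT.
  have [gi g2] := answer_second_moment
    (dual_norm_measurable (@F_measurable _) gF)
    (fun w => (f'P (QX w)).2) (noise iT).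
  exact: mean_bound_self.
have noise_bound : mean_bound P
    (fun w => \sum_(i < n) ((f' (X (k * n + i)%N w) - g (k * n + i)%N w)
       (X (k * n + i)%N w - Z w) : R)) (\sum_(i < n) 0).
  apply: mean_bound_sum => i; apply: noise_mean_bound => //.
    exact: stage_index.
  by apply: borelW ZF; exact: leq_addr.
have n1 : 0 < n.+1%:R^-1 :> R by rewrite invr_gt0 ltr0n.
(* The [n] answers contribute [2 * S2] each, and the unqueried last point contributes
   [L ^+ 2 <= 2 * S2], as one further answer would. *)
have rate : n.+1%:R^-1 * (beta * (Cd * (D / R0 ^+ 2))
    + (c * \sum_(i < n) 2 * S2 + c * L ^+ 2) + \sum_(i < n) 0) + 0 <=
    kappa / 2 * (D / r + 2 * r).
  have -> : \sum_(i < n) (0 : R) = 0 by rewrite big1.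
  rewrite !addr0 ler_pdivrMl ?ltr0n//.
  have := @stage_rate R Cd mud S2 R0 r D lN N n Cd_gt0 mud_gt0 S2_gt0 R0_gt0
    (radius_gt0 k) D0 lN_gt0 N_gt0 n_large.
  apply: le_trans; rewrite lerD2l -mulrDr ler_wpM2l//.
  rewrite sumr_const card_ord -[_ *+ n]mulr_natl -[n.+1%:R]natr1.
  rewrite [leRHS]mulrDl mul1r lerD2l.
  have := sqr_ge0 sigma; have := sqr_ge0 L; lra.
apply: mean_boundW rate _.
have := mean_boundD (mean_boundD distance_bound
  (mean_bound_affine (c * L ^+ 2) c0 answers_bound)) noise_bound.
move/(mean_bound_affine 0 (ltW n1)); apply: mean_bound_le => w.
rewrite addr0 ler_pdivlMl ?ltr0n//.
(* A ball of radius [R0] centred in [Q] contains [Q], so any comparator with values in [Q] is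
   admissible. *)
have QRZ : (Q `&` cball (y k w) R0) (Z w).
  split=> //; rewrite /cball/=; apply: Q_diameter => //.
  exact: stage_center_in.
have := @sda_output_bound _ _ Q d mud Q_closed Q_bounded Q_convex mud_gt0 d_prox
  f f' L Cd (stage_gamma mud Cd L sigma R0 k) (y k w) R0 n
  (fun i => g (k * n + i)%N w) (Z w) f'P d_growth (stage_center_in k w) R0_gt0
  (stage_gamma_gt0 k) QRZ.
have -> : \sum_(i < n) ((f' (X (k * n + i)%N w) - g (k * n + i)%N w)
       (X (k * n + i)%N w - Z w) : R) = \sum_(i < n)
    ((f' (sda_point Q d (stage_gamma mud Cd L sigma R0 k) (y k w)
    R0 n (fun i => g (k * n + i)%N w) i) - g (k * n + i)%N w)
     (sda_point Q d (stage_gamma mud Cd L sigma R0 k) (y k w)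
    R0 n (fun i => g (k * n + i)%N w) i - Z w) : R).
  by apply: eq_bigr => i _; rewrite query_point_stage.
by rewrite -/beta -/c [L ^+ 2 + _]addrC (mulrDr c).
Qed.

(** The tangent inequality is used at [b = r / 2], because growth is stated for half the distance.
    The threshold on [r] is exactly [3 * kappa * r <= muf * b ^ rho], under which the mean of the
    tangent bound is at most [b ^ 2]. *)
Lemma center_distance_bound k (r : R) : 0 < r ->
  2 * (6 * kappa / muf) `^ (rho - 1)^-1 <= r ->
  mean_bound P (fun w => f (y k w) - f xs) (3 * kappa * r) ->
  mean_bound P (fun w => `|xs - y k w| ^+ 2) (r ^+ 2).
Proof.
move=> r0 rlarge fy.
have rho1 : 1 < rho by apply: lt_le_trans rho_ge2; rewrite ltr1n.
have rho0 : 0 < rho by exact: lt_trans rho1.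
pose b := r / 2.
have b0 : 0 < b by rewrite divr_gt0.
have brho0 : 0 < b `^ rho by exact: powR_gt0.
have bl : 6 * kappa / muf <= b `^ (rho - 1).
  apply: root_le_powR => //; rewrite ?(ltW b0)//.
    by rewrite divr_ge0 ?mulr_ge0// ltW.
  by rewrite /b ler_pdivlMr// mulrC.
have kb : 3 * kappa * r / (muf * b `^ rho) <= 1.
  rewrite ler_pdivrMr ?mulr_gt0// mul1r powR_split ?(ltW b0)//.
  have := bl; rewrite ler_pdivrMr// => h.
  have : b * (6 * kappa) <= b * (b `^ (rho - 1) * muf) by rewrite ler_pM2l.
  have -> : 3 * kappa * r = b * (6 * kappa) by rewrite /b; field.
  by move/le_trans; apply; rewrite le_eqVlt; apply/orP; left; apply/eqP; ring.
pose a := 4 * b ^+ 2 * (2 / rho) / (muf * b `^ rho).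
have a0 : 0 <= a.
  by rewrite !(mulr_ge0, divr_ge0, exprn_ge0, invr_ge0)// ltW.
have value : a * (3 * kappa * r) + 4 * b ^+ 2 * (1 - 2 / rho) <= r ^+ 2.
  have -> : r ^+ 2 = 4 * b ^+ 2 by rewrite /b; field.
  have -> : a * (3 * kappa * r) = 4 * b ^+ 2 * (2 / rho) *
    (3 * kappa * r / (muf * b `^ rho)) by rewrite /a; ring.
  have q0 : 0 <= 4 * b ^+ 2 * (2 / rho).
    by rewrite mulr_ge0 ?divr_ge0 ?mulr_ge0 ?exprn_ge0 ?(ltW r0) ?(ltW rho0).
  have := ler_wpM2l q0 kb; rewrite mulr1; lra.
apply: mean_boundW value _.
apply: mean_bound_le (mean_bound_affine _ a0 fy) => w.
have := uniformly_convex_growth Q_convex rho_ge2 f_uc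
  (stage_center_in k w) Q_xs f_min.
rewrite distrC; set u := `|_| / 2 => growth.
have u0 : 0 <= u by rewrite divr_ge0.
have -> : `|xs - y k w| ^+ 2 = 4 * u ^+ 2 by rewrite /u; field.
have := square_le_powR u0 b0 rho_ge2.
have : b ^+ 2 * (2 / rho * (u `^ rho / b `^ rho)) <=
    a / 4 * (f (y k w) - f xs).
  have -> : b ^+ 2 * (2 / rho * (u `^ rho / b `^ rho)) =
      a / 4 * (muf * u `^ rho) by rewrite /a; field; rewrite !gt_eqF.
  by rewrite ler_wpM2l// divr_ge0.
lra.
Qed.

Lemma multistage_mean_bound k : (0 < k)%N -> (k <= m)%N ->
  mean_bound P (fun w => f (y k w) - f xs) (3 * kappa * radius k) \/
  mean_bound P (fun w => f (y k w) - f xs)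
    (5 * kappa * (2 * (6 * kappa / muf) `^ (rho - 1)^-1)).
Proof.
set rs := 2 * _ `^ _.
(* Subtracting [2 * kappa * radius k] reserves room for all later increments
   [2 * kappa * radius k.+1], ..., and makes the second alternative inductive. *)
move=> k0 km; suff : mean_bound P (fun w => f (y k w) - f xs) (3 * kappa * radius k) \/
  mean_bound P (fun w => f (y k w) - f xs) (5 * kappa * rs - 2 * kappa * radius k).
  case; [by left|right; apply: mean_boundW b].
  by rewrite gerBl mulr_ge0 ?mulr_ge0// ltW.
have halve j : radius j = 2 * radius j.+1.
  by rewrite exprS; field; rewrite expf_neq0.
have good j : (j < m)%N ->
    mean_bound P (fun w => `|xs - y j w| ^+ 2) (radius j ^+ 2) ->
    mean_bound P (fun w => f (y j.+1 w) - f xs) (3 * kappa * radius j.+1).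
  move=> jm dist.
  have := stage_mean_bound jm (fun=> Q_xs) (@borel_cst _ _)
    (sqr_ge0 (radius j)) dist.
  apply: mean_boundW; rewrite expr2 mulfK ?gt_eqF// (halve j); lra.
have step j v : (j < m)%N -> mean_bound P (fun w => f (y j w) - f xs) v ->
    mean_bound P (fun w => f (y j.+1 w) - f xs) (v + 2 * kappa * radius j.+1).
  move=> jm fv.
  have dist : mean_bound P (fun w => `|y j w - y j w| ^+ 2) 0.
    apply: mean_bound_le (mean_bound_cst P 0) => w.
    by rewrite subrr normr0 expr0n.
  have := mean_boundD (stage_mean_bound jm (stage_center_in j) (center_measurable jm)
    (lexx 0) dist) fv.
  rewrite mul0r add0r (halve j).
  have -> : kappa / 2 * (2 * (2 * radius j.+1)) + v =
    v + 2 * kappa * radius j.+1 by field.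
  by apply: mean_bound_le => w; lra.
elim: k k0 km => // k IH _ km.
(* No value bound is available at [x0]: the first stage relies on the diameter alone. *)
have [->|k0] := eqVneq k 0%N.
  left; apply: good; first by apply: leq_ltn_trans km.
  apply: mean_bound_le (mean_bound_cst P _) => w /=.
  by rewrite expr0 divr1 lerXn2r ?nnegrE ?(ltW R0_gt0)// Q_diameter.
have [] := IH _ (ltnW km); first by rewrite lt0n.
- move=> fk; have [rk|rk] := leP rs (radius k).
    by left; apply: good => //; exact: center_distance_bound.
  (* At the crossing the total is [8 * kappa * radius k.+1], and [2 * radius k.+1 < rs] fits it into
     the second alternative. *)
  right; apply: mean_boundW (step _ _ km fk).
  move: rk; rewrite (halve k) => rk.
  have : kappa * (2 * radius k.+1) <= kappa * rs by rewrite ler_pM2l// ltW.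
  lra.
- move=> fk; right; apply: mean_boundW (step _ _ km fk).
  rewrite (halve k); lra.
Qed.

End MultistageConvergence.

Theorem theorem6 (R : realType) (E : normedVectType R)
    (Q : set E) (f : E -> R) (f' : E -> 'Hom(E, R^o)) (rho muf L fstar R0 : R)
    (d : E -> R) (mud Cd : R)
    (disp : measure_display) (Omega : measurableType disp)
    (P : probability Omega R) (F : nat -> set (set Omega))
    (g : nat -> Omega -> 'Hom(E, R^o)) (sigma : R)
    (N m : nat) (x0 : E)
    (N0 := (N %/ m)%N)
    (y := fun w => stage_center Q d mud Cd L sigma R0 x0 N0 (fun t => g t w))
    (X := fun t w =>
       query_point Q d mud Cd L sigma R0 x0 N0 (fun t => g t w) t) :
  Q !=set0 -> closed Q -> convex_set (Q : set (convex_lmodType E)) ->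
  bounded_set Q -> R0 = diameter Q -> 0 < R0 ->
  2 <= rho -> 0 < muf -> uniformly_convex Q f rho muf ->
  0 < L ->
  (forall x, Q x -> subdifferential Q f x (f' x) /\ dual_norm (f' x) <= L) ->
  is_min f Q fstar ->
  0 < mud -> prox_function d mud -> quadratic_growth_constant d Cd ->
  filtration F -> F 0%N = [set set0; setT] ->
  (4 < N)%N -> Q x0 ->
  m%:Z = Num.floor (2^-1 * log2 (mud * N%:R / (Cd * log2 N%:R))) - 1 ->
  (1 <= m)%N ->
  unbiased_oracle P Q f f' F X g (m * N0) ->
  (ereal_sup [set 'E_P[(fun w => dual_norm (g t w - f' (X t w)) ^+ 2)%R]
             | t in [set t | (t < m * N0)%N]] <= (sigma ^+ 2)%:E)%E ->
  ('E_P[(fun w => f (y w m))%R] - fstar%:E <=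
    (4 * (16 * (L ^+ 2 + sigma ^+ 2) * Cd * log2 N%:R
          / (muf `^ (2 / rho) * mud * N%:R))
         `^ (rho / (2 * (rho - 1))))%:E)%E.
Proof.
move=> Q0 Qc Qconv Qb R0E R00 rho2 muf0 fuc L0 f'P [[xs Qxs <-] fmin] mud0 dprox
  [dC _] Ffilt _ N4 Qx0 mE m1 oracle noise.
have Qdiam x z : Q x -> Q z -> `|x - z| <= R0.
  by move=> Qx Qz; rewrite R0E; exact: diameter_ge.
(* A positive diameter excludes the zero space, where [mud] and [Cd] could not be compared. *)
have [e e0] : exists e : E, e != 0.
  apply: contrapT => E0; move: R00; rewrite R0E ltNge => /negP; apply.
  apply: diameter_le => // x z _ _; rewrite (_ : x - z = 0) ?normr0//.
  by apply: contrapT => /eqP xz; apply: E0; exists (x - z).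
have mudC := prox_modulus_le e0 dprox dC.
have C0 : 0 < Cd by lra.
have [lN2 n0 n_large Am A16] := stage_count N4 m1 mud0 mudC mE.
set lN := log2 _ in lN2 n_large Am A16 *.
clearbody lN.
set A := mud * _ / _ in Am A16.
have l0 : 0 < lN by lra.
have N0' : (0 : R) < N%:R by rewrite ltr0n (ltn_trans _ N4).
set S2 := L ^+ 2 + sigma ^+ 2.
have S20 : 0 < S2 by rewrite ltr_pwDl ?exprn_gt0// sqr_ge0.
have noise_t t : (t < m * N0)%N ->
    ('E_P[fun w => (dual_norm (g t w - f' (X t w)) ^+ 2)%R]
      <= (sigma ^+ 2)%:E)%E.
  by move=> tT; apply: le_trans noise; apply: ereal_sup_ubound; exists t.
rewrite target_rate//; set kappa := Num.sqrt _.
set target := 16 * _ * _.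
have k0 : 0 < kappa by rewrite sqrtr_gt0 divr_gt0// !mulr_gt0.
have A0 : 0 < A by lra.
have kE : kappa ^+ 2 = S2 / A.
  rewrite sqr_sqrtr ?divr_ge0 ?mulr_ge0 ?ltW// /A; field; rewrite !gt_eqF//.
pose S := Num.sqrt S2.
have S0 : 0 < S by rewrite sqrtr_gt0.
have SE : S ^+ 2 = S2 by rewrite sqr_sqrtr// ltW.
have LS : L <= S.
  rewrite -(@ler_pXn2r _ 2)// ?nnegrE ?(ltW L0) ?(ltW S0)// SE lerDl.
  exact: sqr_ge0.
(* Since [kappa ^+ 2 = S2 / A], this is [16 <= A], and the next claim is [A < 16 * 4 ^ m]. *)
have kS : 4 * kappa / S <= 1.
  rewrite ler_pdivrMr// mul1r -(@ler_pXn2r _ 2)// ?nnegrE ?(ltW S0)//; last first.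
    by rewrite mulr_ge0// ltW.
  by rewrite exprMn kE SE mulrA ler_pdivrMr// mulrC -natrX ler_pM2l.
have pk : (2 ^+ m)^-1 <= 4 * kappa / S.
  have t0 : 0 < 2 ^+ m :> R by rewrite exprn_gt0.
  rewrite ler_pdivlMr// ler_pdivrMl// -(@ler_pXn2r _ 2)// ?nnegrE ?(ltW S0)//;
    last by rewrite !mulr_ge0// ltW.
  rewrite SE !exprMn kE.
  have -> : (2 ^+ m) ^+ 2 * (4 ^+ 2 * (S2 / A)) = S2 * (16 * (2 ^+ m) ^+ 2) / A.
    by field; rewrite gt_eqF.
  by rewrite ler_pdivlMr// ler_pM2l// ltW.
have R0_le : R0 <= 2 * (2 * L / muf) `^ (rho - 1)^-1.
  rewrite R0E; apply: diameter_le => // x z Qx Qz.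
  exact: (uniformly_convex_distance Qconv rho2 muf0 fuc f'P).
have bound : mean_bound P (fun w => f (y w m) - f xs) target.
  have [] := @multistage_mean_bound R E Q f f' rho muf L R0 d mud Cd disp Omega P
    F g sigma m N0 x0 xs N%:R lN Qc Qb Qconv Qdiam R00 rho2 muf0 fuc L0 f'P Qxs
    fmin mud0 dprox C0 dC Ffilt Qx0 n0 N0' l0 n_large oracle noise_t m m1 (leqnn m);
    apply: mean_boundW; last exact: late_stage_rate.
  apply: (@last_stage_rate _ _ _ _ L S) => //.
have Qy w : Q (y w m).
  exact: (stage_center_in g sigma N0 Qc Qb Qconv R00 L0 mud0 dprox C0 Qx0).
rewrite leeBlDr//.
(* The subgradient at [y w m] bounds [f] there uniformly in [w]; this constant serves on the null
   set where the majorant may fail. *)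
apply: (@expectation_le_bound _ _ _ P _ (f xs + L * R0)) => [w|].
  have [sub dn] := f'P _ (Qy w); have := sub _ Qxs.
  have := dual_normP_abs (f' (y w m)) (xs - y w m).
  rewrite ler_norml => /andP[h _].
  have : dual_norm (f' (y w m)) * `|xs - y w m| <= L * R0.
    by rewrite ler_pM ?dual_norm_ge0// Qdiam.
  lra.
have := mean_bound_affine (f xs) ler01 bound; rewrite mul1r.
by apply: mean_bound_le => w; rewrite mul1r subrK.
Qed.
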